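(* Let $R$ be a commutative noetherian local ring and $M$ a finitely generated $R$-module of finite G-dimension. Fix an integer $i$ and a G-approximation $0\to K\to G\to M\to 0$. (a) For $i\geq 2$, one has $\chi^{\mathcal{G}}_i(M)=0$ if and only if $\operatorname{G-dim}_R(M)<i$. (b) The following conditions (i), (ii), (iii) are equivalent: (i) $\chi^{\mathcal{G}}_1(M)=\beta_0^R(M)-\beta_0^R(G)$; (ii) $\operatorname{G-dim}_R(M)=0$ and the given G-approximation is minimal; (iii) $K=0$; and they imply the following condition: (iv) $\chi^{\mathcal{G}}_1(M)=0$.
   Context: Let $(R,\mathfrak{m},k)$ be a commutative noetherian local ring and set $(-)^*=\operatorname{Hom}_R(-,R)$. A finitely generated $R$-module $G$ is totally reflexive if the biduality map $G\to G^{**}$ is bijective and $\operatorname{Ext}^i_R(G,R)=0=\operatorname{Ext}^i_R(G^*,R)$ for all $i\neq 0$. A G-resolution of a finitely generated module $M$ is a complex $G$ of totally reflexive modules with $G_n=0$ for $n<0$, $H_n(G)=0$ for $n>0$ and $H_0(G)\cong M$; its augmented G-resolution $G^+$ is the exact sequence $\cdots\to G_1\to G_0\to M\to 0$. The G-dimension is $\operatorname{G-dim}_R(M)=\inf\{\sup\{n\geq 0\mid G_n\neq 0\}\mid G \text{ is a G-resolution of } M\}$. A G-resolution $G$ is proper if $\operatorname{Hom}_R(H,G^+)$ is exact for every totally reflexive $R$-module $H$. Every finitely generated $M$ of finite G-dimension has a bounded proper G-resolution, and proper G-resolutions are unique up to homotopy equivalence, so $\operatorname{Tor}^{\mathcal{G}}_n(M,N)=H_n(G\otimes_R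 N)$, with $G$ a proper G-resolution of $M$, is well defined. The relative Betti numbers are $\beta_n^{\mathcal{G}}(M)=\dim_k\operatorname{Tor}_n^{\mathcal{G}}(M,k)$, which vanish for $n<0$ and $n>\operatorname{G-dim}_R(M)$. For $i\geq 0$, the $i$th G-Euler characteristic is $\chi^{\mathcal{G}}_i(M)=\sum_{n\geq i}(-1)^{n-i}\beta_n^{\mathcal{G}}(M)$. Also $\beta_0^R(M)=\dim_k(M\otimes_R k)$ is the minimal number of generators of $M$. A G-approximation of $M$ is an exact sequence $0\to K\to G\to M\to 0$ of finitely generated modules with $G$ totally reflexive and $K$ of finite projective dimension. It is minimal if every homotopy equivalence from the complex $0\to K\to G\to 0$ to itself is an isomorphism; equivalently, $K$ contains no nonzero free direct summand of $G$. *)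

(* Defs.v *)
From HB Require Import structures.
From mathcomp Require Import all_boot all_order all_algebra.
From mathcomp Require Import generic_quotient ring_quotient.
From mathcomp Require Import boolp classical_sets functions fsbigop.
From mathcomp Require Import constructive_ereal.
From mathcomp Require Import freeg.

Set Implicit Arguments.
Unset Strict Implicit.
Unset Printing Implicit Defensive.

Import Order.TTheory GRing.Theory Num.Theory.
Local Open Scope classical_set_scope.
Local Open Scope ring_scope.
Local Open Scope quotient_scope.

Section Rings.
Variable R : comNzRingType.
Implicit Types I J : set R.

Definition is_ideal I :=
  [/\ I 0, forall x y, I x -> I y -> I (x + y) & forall a x, I x -> I (a * x)].

Definition noetherian_ring :=
  forall I, is_ideal I -> exists n (a : 'I_n -> R),
    I = [set x | exists c : 'I_n -> R, x = \sum_i c i * a i].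

Definition maximal_ideal I :=
  [/\ is_ideal I, ~ I 1 & forall J, is_ideal J -> ~ J 1 -> I `<=` J -> J = I].

Definition local_ring := exists! I, maximal_ideal I.
End Rings.

Section LinearExt.
Variables (R : pzRingType) (U V : lmodType R).

Lemma linear_ext (f g : {linear U -> V}) : f =1 g -> f = g.
Proof.
case: f g => f cf [g cg] /= /funext fg; case: _ / fg cg => cg; congr GRing.Linear.Pack.
case: cf cg => [[[pf0 pfD]] [pfZ]] [[[pg0 pgD]] [pgZ]].
rewrite (Prop_irrelevance pf0 pg0) (Prop_irrelevance pfD pgD).
by rewrite (Prop_irrelevance pfZ pgZ).
Qed.

End LinearExt.

Definition trivial_module (R : pzRingType) (M : lmodType R) :=
  forall x : M, x = 0.

Definition fin_gen (R : pzRingType) (M : lmodType R) :=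
  exists n (v : 'I_n -> M), forall x, exists c : 'I_n -> R, x = \sum_i c i *: v i.

Definition projective_module (R : pzRingType) (P : lmodType R) :=
  forall (A B : lmodType R) (f : {linear A -> B}) (g : {linear P -> B}),
    (forall b, exists a, f a = b) -> exists h : {linear P -> A}, f \o h =1 g.

Section Kernel.
Variables (R : pzRingType) (U V : lmodType R) (f : {linear U -> V}).

Definition ker_pred : {pred U} := fun x => f x == 0.

Fact ker_pred_submod : GRing.submod_closed ker_pred.
Proof.
split=> [|a x y]; rewrite !unfold_in ?linear0 // => /eqP fx /eqP fy.
by rewrite linearP fx fy scaler0 addr0.
Qed.

HB.instance Definition _ :=
  GRing.isSubmodClosed.Build R U ker_pred ker_pred_submod.

Record kermod := KerMod { kermod_val :> U; _ : kermod_val \in ker_pred }.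
HB.instance Definition _ := [isSub for kermod_val].
HB.instance Definition _ := [Choice of kermod by <:].
HB.instance Definition _ := [SubChoice_isSubLmodule of kermod by <:].

End Kernel.

Section QuotientModule.
Variables (R : pzRingType) (V : lmodType R) (S : submodClosed V).

(* A [submodClosed] has no canonical [zmodClosed] structure, which
   [Quotient.quot] asks for. *)
Definition submod_pred : {pred V} := fun x => x \in S.
Fact submod_pred_zmod : zmod_closed submod_pred.
Proof.
split=> [|x y]; first exact: (rpred0 S).
move=> Sx Sy; change (x - y \in S); rewrite -scaleN1r.
by apply: rpredD => //; apply: rpredZ.
Qed.
HB.instance Definition _ :=
  GRing.isZmodClosed.Build V submod_pred submod_pred_zmod.

Definition quotmod := Quotient.quot submod_pred.
HB.instance Definition _ := GRing.Zmodule.on quotmod.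

Definition quotmod_proj (x : V) : quotmod := \pi_(Quotient.quot submod_pred) x.
Definition quotmod_scale (a : R) (q : quotmod) : quotmod :=
  quotmod_proj (a *: repr (q : Quotient.quot submod_pred)).

Lemma quotmod_projK (q : quotmod) : quotmod_proj (repr (q : Quotient.quot submod_pred)) = q.
Proof. exact: reprK. Qed.

Lemma quotmod_eqP (x y : V) : quotmod_proj x = quotmod_proj y <-> x - y \in S.
Proof. by rewrite -[_ \in S]/(_ \in submod_pred) Quotient.idealrBE; split=> /eqP. Qed.

Lemma quotmod_proj_zmod : zmod_morphism quotmod_proj.
Proof. by move=> x y; rewrite /quotmod_proj !piE. Qed.

Lemma quotmod_scaleE a x : quotmod_scale a (quotmod_proj x) = quotmod_proj (a *: x).
Proof.
apply/quotmod_eqP; rewrite -scalerBr rpredZ //.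
exact/quotmod_eqP/quotmod_projK.
Qed.

Lemma quotmod_projD x y : quotmod_proj (x + y) = quotmod_proj x + quotmod_proj y.
Proof. by rewrite /quotmod_proj !piE. Qed.

Fact quotmod_scaleA a b q :
  quotmod_scale a (quotmod_scale b q) = quotmod_scale (a * b) q.
Proof. by rewrite -[q]quotmod_projK !quotmod_scaleE scalerA. Qed.
Fact quotmod_scale1 : left_id 1 quotmod_scale.
Proof. by move=> q; rewrite -[q]quotmod_projK quotmod_scaleE scale1r. Qed.
Fact quotmod_scaleDr : right_distributive quotmod_scale +%R.
Proof.
move=> a p q; rewrite -[p]quotmod_projK -[q]quotmod_projK.
by rewrite -quotmod_projD !quotmod_scaleE scalerDr quotmod_projD.
Qed.
Fact quotmod_scaleDl q : {morph quotmod_scale^~ q : a b / a + b}.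
Proof.
move=> a b; rewrite -[q]quotmod_projK !quotmod_scaleE scalerDl.
exact: quotmod_projD.
Qed.

HB.instance Definition _ := GRing.Zmodule_isLmodule.Build R quotmod
  quotmod_scaleA quotmod_scale1 quotmod_scaleDr quotmod_scaleDl.

Fact quotmod_proj_linear : linear quotmod_proj.
Proof.
by move=> a x y; rewrite quotmod_projD -quotmod_scaleE.
Qed.
HB.instance Definition _ :=
  GRing.isLinear.Build R V quotmod *:%R quotmod_proj quotmod_proj_linear.

Section Lift.
Variables (W : lmodType R) (f : {linear V -> W}).
Hypothesis fS : forall x, x \in S -> f x = 0.

Definition quotmod_lift_fun of (forall x, x \in S -> f x = 0) :=
  fun q : quotmod => f (repr (q : Quotient.quot submod_pred)).
Local Notation lift := (quotmod_lift_fun fS).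

Lemma quotmod_lift_funE x : lift (quotmod_proj x) = f x.
Proof.
apply/eqP; rewrite -subr_eq0 -linearB; apply/eqP/fS.
exact/quotmod_eqP/quotmod_projK.
Qed.

Fact quotmod_lift_linear : linear lift.
Proof.
move=> a p q; rewrite -[p]quotmod_projK -[q]quotmod_projK -linearP.
by rewrite !quotmod_lift_funE linearP.
Qed.
HB.instance Definition _ :=
  GRing.isLinear.Build R quotmod W *:%R lift quotmod_lift_linear.
Definition quotmod_lift : {linear quotmod -> W} := lift.

Lemma quotmod_liftE x : quotmod_lift (quotmod_proj x) = f x.
Proof. exact: quotmod_lift_funE. Qed.
End Lift.

End QuotientModule.

(** The homology at [B] of [A -f-> B -g-> C]. The quotient is by
    [im f] intersected with [ker g], which is [im f] when [g \o f = 0]. *)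
Section Homology.
Variables (R : pzRingType) (A B C : lmodType R).
Variables (f : {linear A -> B}) (g : {linear B -> C}).

Definition boundary_pred : {pred kermod g} :=
  fun z => `[< exists x, f x = val z >].

Fact boundary_submod : GRing.submod_closed boundary_pred.
Proof.
split=> [|a y z]; rewrite !unfold_in.
  by apply/asboolP; exists 0; rewrite linear0 raddf0.
move=> /asboolP[x fx] /asboolP[x' fx']; apply/asboolP; exists (a *: x + x').
by rewrite linearP fx fx' -linearP.
Qed.
HB.instance Definition _ :=
  GRing.isSubmodClosed.Build R (kermod g) boundary_pred boundary_submod.

Definition homology : lmodType R := quotmod boundary_pred.

Lemma trivial_homologyP :
  trivial_module homology <-> forall y, g y = 0 -> exists x, f x = y.
Proof.
split=> [H y gy | H q].
  have ky : y \in ker_pred g by rewrite unfold_in; apply/eqP.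
  have := H (quotmod_proj boundary_pred (KerMod ky)).
  rewrite -(linear0 (quotmod_proj boundary_pred)) => /quotmod_eqP.
  by rewrite subr0 unfold_in => /asboolP.
rewrite -[q]quotmod_projK -(linear0 (quotmod_proj boundary_pred)).
apply/quotmod_eqP; rewrite subr0 unfold_in; apply/asboolP.
by case: (repr _) => y /= ky; apply: H; apply/eqP.
Qed.
End Homology.

Section Hom.
Variables (R : comNzRingType) (M N : lmodType R).
Local Notation hom := {linear M -> N}.
Implicit Types f g h : hom.

HB.instance Definition _ := gen_eqMixin hom.
HB.instance Definition _ := gen_choiceMixin hom.

Definition hom_zero : hom := \0.
Definition hom_opp f : hom := \- f.
Definition hom_add f g : hom := f \+ g.
Definition hom_scale (a : R) f : hom := a \*: f.

Fact hom_addA : associative hom_add.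
Proof. by move=> f g h; apply: linear_ext => x; exact: addrA. Qed.
Fact hom_addC : commutative hom_add.
Proof. by move=> f g; apply: linear_ext => x; exact: addrC. Qed.
Fact hom_add0 : left_id hom_zero hom_add.
Proof. by move=> f; apply: linear_ext => x; exact: add0r. Qed.
Fact hom_addN : left_inverse hom_zero hom_opp hom_add.
Proof. by move=> f; apply: linear_ext => x; exact: addNr. Qed.
HB.instance Definition _ :=
  GRing.isZmodule.Build hom hom_addA hom_addC hom_add0 hom_addN.

Fact hom_scaleA a b f : hom_scale a (hom_scale b f) = hom_scale (a * b) f.
Proof. by apply: linear_ext => x; exact: scalerA. Qed.
Fact hom_scale1 : left_id 1 hom_scale.
Proof. by move=> f; apply: linear_ext => x; exact: scale1r. Qed.
Fact hom_scaleDr : right_distributive hom_scale +%R.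
Proof. by move=> a f g; apply: linear_ext => x; exact: scalerDr. Qed.
Fact hom_scaleDl f : {morph hom_scale^~ f : a b / a + b}.
Proof. by move=> a b; apply: linear_ext => x; exact: scalerDl. Qed.
HB.instance Definition _ := GRing.Zmodule_isLmodule.Build R hom
  hom_scaleA hom_scale1 hom_scaleDr hom_scaleDl.
End Hom.

Section HomFunctor.
Variables (R : comNzRingType) (A B : lmodType R) (f : {linear A -> B}).

Definition precomp_fun (N : lmodType R) (h : {linear B -> N}) : {linear A -> N} :=
  h \o f.
Fact precomp_linear (N : lmodType R) : linear (@precomp_fun N).
Proof. by move=> a g h; exact: linear_ext. Qed.
HB.instance Definition _ (N : lmodType R) := GRing.isLinear.Build R {linear B -> N}
  {linear A -> N} *:%R (@precomp_fun N) (@precomp_linear N).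
Definition precomp (N : lmodType R) : {linear {linear B -> N} -> {linear A -> N}} :=
  @precomp_fun N.

Definition postcomp_fun (H : lmodType R) (h : {linear H -> A}) : {linear H -> B} :=
  f \o h.
Fact postcomp_linear (H : lmodType R) : linear (@postcomp_fun H).
Proof. by move=> a g h; apply: linear_ext => x; exact: linearP. Qed.
HB.instance Definition _ (H : lmodType R) := GRing.isLinear.Build R {linear H -> A}
  {linear H -> B} *:%R (@postcomp_fun H) (@postcomp_linear H).
Definition postcomp (H : lmodType R) : {linear {linear H -> A} -> {linear H -> B}} :=
  @postcomp_fun H.
End HomFunctor.

Definition dual (R : comNzRingType) (M : lmodType R) : lmodType R :=
  {linear M -> R^o}.

Section BidualityMap.
Variables (R : comNzRingType) (M : lmodType R).

Definition eval_at (x : M) (phi : dual M) : R^o := (phi : {linear M -> R^o}) x.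
Fact eval_at_linear x : linear (eval_at x).
Proof. by []. Qed.
HB.instance Definition _ (x : M) :=
  GRing.isLinear.Build R (dual M) R^o *:%R (eval_at x) (@eval_at_linear x).
Definition biduality_fun (x : M) : dual (dual M) :=
  (eval_at x : {linear dual M -> R^o}).
Fact biduality_linear : linear biduality_fun.
Proof. by move=> a x y; apply: linear_ext => phi; exact: linearP. Qed.
HB.instance Definition _ :=
  GRing.isLinear.Build R M (dual (dual M)) *:%R biduality_fun biduality_linear.
Definition biduality : {linear M -> dual (dual M)} := biduality_fun.
End BidualityMap.

Section FreeModule.
Variables (R : comNzRingType) (X : choiceType) (M : lmodType R) (phi : X -> M).

Fact fglift_linear : linear (fglift phi : {freeg X / R} -> M).
Proof.
have addf x y : fglift phi (x + y) = fglift phi x + fglift phi y.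
  have := lift_is_additive phi; move=> H.
  by rewrite -{1}[y]opprK H -[- y]add0r H -{1}(subrr 0) H !subrr sub0r opprK.
have sumf I (r : seq I) (F : I -> {freeg X / R}) :
    fglift phi (\sum_(i <- r) F i) = \sum_(i <- r) fglift phi (F i).
  apply: (big_morph _ addf); by rewrite -(subrr 0) lift_is_additive subrr.
move=> a x y; rewrite addf; congr (_ + _).
have -> : fglift phi x = \sum_(z <- dom x) coeff z x *: phi z.
  by rewrite -{1}[x]freeg_sumE sumf; apply: eq_bigr => z _; rewrite liftU.
rewrite [a *: x]/(fgscale a x) /fgscale sumf scaler_sumr.
by apply: eq_bigr => z _; rewrite liftU scalerA.
Qed.
HB.instance Definition _ := GRing.isLinear.Build R {freeg X / R} M *:%R
  (fglift phi) fglift_linear.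
Definition free_lift : {linear {freeg X / R} -> M} := fglift phi.
End FreeModule.

Section Tensor.
Variables (R : comNzRingType) (M N : lmodType R).
Local Notation F := {freeg (M * N) / R}.
Local Notation "x @ y" := (<< (x, y) >> : F) (at level 35).

Inductive tensor_relator : F -> Prop :=
| TensorDl x x' y : tensor_relator ((x + x') @ y - (x @ y + x' @ y))
| TensorDr x y y' : tensor_relator (x @ (y + y') - (x @ y + x @ y'))
| TensorZl a x y : tensor_relator ((a *: x) @ y - a *: (x @ y))
| TensorZr a x y : tensor_relator (x @ (a *: y) - a *: (x @ y)).

Definition tensor_rels : {pred F} := fun z =>
  `[< forall W : {pred F}, GRing.submod_closed W ->
      (forall r, tensor_relator r -> r \in W) -> z \in W >].

Fact tensor_rels_submod : GRing.submod_closed tensor_rels.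
Proof.
split=> [|a x y]; rewrite !unfold_in.
  by apply/asboolP=> W [].
move=> /asboolP Wx /asboolP Wy; apply/asboolP=> W clW relW.
by case: (clW) => _; apply; [apply: Wx | apply: Wy].
Qed.
HB.instance Definition _ :=
  GRing.isSubmodClosed.Build R F tensor_rels tensor_rels_submod.

Definition tensor : lmodType R := quotmod tensor_rels.
Definition tens (x : M) (y : N) : tensor := quotmod_proj tensor_rels (x @ y).

Lemma tensor_relatorP r : tensor_relator r -> r \in tensor_rels.
Proof. by move=> rr; rewrite unfold_in; apply/asboolP=> W _; apply. Qed.

Lemma tensDl x x' y : tens (x + x') y = tens x y + tens x' y.
Proof.
rewrite /tens -linearD; apply/quotmod_eqP/tensor_relatorP; exact: TensorDl.
Qed.
Lemma tensDr x y y' : tens x (y + y') = tens x y + tens x y'.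
Proof.
rewrite /tens -linearD; apply/quotmod_eqP/tensor_relatorP; exact: TensorDr.
Qed.
Lemma tensZl a x y : tens (a *: x) y = a *: tens x y.
Proof.
rewrite /tens -linearZ; apply/quotmod_eqP/tensor_relatorP; exact: TensorZl.
Qed.
Lemma tensZr a x y : tens x (a *: y) = a *: tens x y.
Proof.
rewrite /tens -linearZ; apply/quotmod_eqP/tensor_relatorP; exact: TensorZr.
Qed.

Lemma tensor_ext (P : lmodType R) (f g : {linear tensor -> P}) :
  (forall x y, f (tens x y) = g (tens x y)) -> f =1 g.
Proof.
move=> fg q; rewrite -[q]quotmod_projK; elim/freeg_ind_dom0: (repr _).
  by rewrite !linear0.
move=> a [x y] D _ _ IH; rewrite !linearD; congr (_ + _) => //.
have -> : << a *g (x, y) >> = a *: (x @ y) :> F.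
  by apply/eqP/freeg_eqP=> z; rewrite coeffZ !coeffU mul1r.
by rewrite !linearZ; congr (_ *: _); exact: fg.
Qed.

Section Lift.
Variables (P : lmodType R) (b : M -> N -> P).
Hypotheses (bl : forall y, linear (b^~ y)) (br : forall x, linear (b x)).

Fact tensor_lift_subproof z :
  z \in tensor_rels -> free_lift (fun p : M * N => b p.1 p.2) z = 0.
Proof.
set h := free_lift _; rewrite unfold_in => /asboolP/(_ (ker_pred h)).
have hU x y : h (x @ y) = b x y by rewrite /h /free_lift /= liftU scale1r.
move=> H; apply/eqP; apply: H => [|r]; first exact: ker_pred_submod.
have blD y x x' : b (x + x') y = b x y + b x' y.
  by have := bl y 1 x x'; rewrite !scale1r.
have brD x y y' : b x (y + y') = b x y + b x y'.
  by have := br x 1 y y'; rewrite !scale1r.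
have bl0 y : b 0 y = 0 by apply: (addrI (b 0 y)); rewrite -blD !addr0.
have br0 x : b x 0 = 0 by apply: (addrI (b x 0)); rewrite -brD !addr0.
have blZ y a x : b (a *: x) y = a *: b x y.
  by have := bl y a x 0; rewrite !addr0 bl0 addr0.
have brZ x a y : b x (a *: y) = a *: b x y.
  by have := br x a y 0; rewrite !addr0 br0 addr0.
case=> *; rewrite unfold_in linearB ?linearD ?linearZ /= !hU.
- by rewrite blD -opprD subrr.
- by rewrite brD -opprD subrr.
- by rewrite blZ scalerN subrr.
- by rewrite brZ scalerN subrr.
Qed.

Definition tensor_lift : {linear tensor -> P} :=
  quotmod_lift tensor_lift_subproof.

Lemma tensor_liftE x y : tensor_lift (tens x y) = b x y.
Proof. by rewrite /tensor_lift quotmod_liftE /free_lift /= liftU scale1r. Qed.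
End Lift.
End Tensor.

Section TensorMap.
Variables (R : comNzRingType) (A B N : lmodType R) (f : {linear A -> B}).

Fact tensor_map_linearl (y : N) : linear (fun x => tens (f x) y).
Proof. by move=> a x x'; rewrite linearP tensDl tensZl. Qed.
Fact tensor_map_linearr x : linear (fun y : N => tens (f x) y).
Proof. by move=> a y y'; rewrite tensDr tensZr. Qed.

Definition tensor_map : {linear tensor A N -> tensor B N} :=
  tensor_lift tensor_map_linearl tensor_map_linearr.

Lemma tensor_mapE x y : tensor_map (tens x y) = tens (f x) y.
Proof. exact: tensor_liftE. Qed.
End TensorMap.

(** Complexes are concentrated in nonnegative homological degrees. *)
Record complex (R : pzRingType) := Complex {
  cpx_mod :> nat -> lmodType R;
  cpx_diff : forall n, {linear cpx_mod n.+1 -> cpx_mod n};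
  cpx_diffK : forall n x, cpx_diff n (cpx_diff n.+1 x) = 0 }.
Arguments cpx_diff {R} c n.

Section Complexes.
Variable R : pzRingType.
Implicit Types C D E : complex R.

Definition cpx_out C n : {linear C n -> C n.-1} :=
  match n with 0 => \0 | m.+1 => cpx_diff C m end.

Definition cpx_homology C n : lmodType R :=
  homology (cpx_diff C n) (cpx_out C n).

Definition acyclic C := forall n, trivial_module (cpx_homology C n).

Record chain_map C D := ChainMap {
  chain_fun :> forall n, {linear C n -> D n};
  chain_comm : forall n x,
    chain_fun n (cpx_diff C n x) = cpx_diff D n (chain_fun n.+1 x) }.

Definition chain_id C : chain_map C C :=
  @ChainMap C C (fun n => idfun) (fun n x => erefl).

Fact chain_comp_subproof C D E (g : chain_map D E) (f : chain_map C D) n x :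
  g n (f n (cpx_diff C n x)) = cpx_diff E n (g n.+1 (f n.+1 x)).
Proof. by rewrite !chain_comm. Qed.
Definition chain_comp C D E (g : chain_map D E) (f : chain_map C D) :
  chain_map C E := @ChainMap C E (fun n => g n \o f n) (chain_comp_subproof g f).

Definition homotopy_low C D (s : forall n, {linear C n -> D n.+1}) n :
    C n -> D n :=
  match n with 0 => fun=> 0 | m.+1 => fun x => s m (cpx_diff C m x) end.

Definition homotopic C D (f g : chain_map C D) :=
  exists s : forall n, {linear C n -> D n.+1}, forall n x,
    f n x - g n x = cpx_diff D n (s n x) + homotopy_low s x.

Definition homotopy_equivalence C D (f : chain_map C D) :=
  exists g : chain_map D C, homotopic (chain_comp g f) (chain_id C) /\
                            homotopic (chain_comp f g) (chain_id D).

Definition chain_iso C D (f : chain_map C D) := forall n, bijective (f n).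

(** The complex [0 -> K -> G -> 0] with [G] in degree 0. *)
Section TwoTerm.
Variables (K G : lmodType R) (iota : {linear K -> G}).
Definition two_term_mod (n : nat) : lmodType R :=
  match n with 0 => G | 1 => K | _ => 'rV[R]_0 end.
Definition two_term_diff n : {linear two_term_mod n.+1 -> two_term_mod n} :=
  match n with 0 => iota | _ => \0 end.
Fact two_term_diffK n x : two_term_diff n (two_term_diff n.+1 x) = 0.
Proof. by case: n x => [|n] x //=; rewrite linear0. Qed.
Definition two_term : complex R := Complex two_term_diffK.
End TwoTerm.

End Complexes.

Section ComplexFunctors.
Variables (R : comNzRingType).

Definition hom_complex_diff (H : lmodType R) (C : complex R) n :=
  postcomp (cpx_diff C n) H.
Fact hom_complex_diffK H C n x :
  hom_complex_diff H C n (hom_complex_diff H C n.+1 x) = 0.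
Proof. by apply: linear_ext => y; exact: cpx_diffK. Qed.
Definition hom_complex H C : complex R := Complex (@hom_complex_diffK H C).

Definition tensor_complex_diff (C : complex R) (N : lmodType R) n :=
  tensor_map N (cpx_diff C n).
Fact tensor_complex_diffK C N n x :
  tensor_complex_diff C N n (tensor_complex_diff C N n.+1 x) = 0.
Proof.
have tens0 y : tens (0 : C n) (y : N) = 0.
  by apply: (addrI (tens 0 y)); rewrite -tensDl !addr0.
rewrite -[LHS]/((tensor_complex_diff C N n \o tensor_complex_diff C N n.+1) x).
rewrite (tensor_ext (g := \0)) // => a b.
rewrite -[LHS]/(tensor_map N (cpx_diff C n)
  (tensor_map N (cpx_diff C n.+1) (tens a b))).
by rewrite !tensor_mapE cpx_diffK tens0.
Qed.
Definition tensor_complex C N : complex R :=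
  Complex (@tensor_complex_diffK C N).

End ComplexFunctors.

(** A complex [C] with [H_n(C) = 0] for [n > 0], and an augmentation
    [C_0 -> M] which induces an isomorphism [H_0(C) ~ M]. *)
Record resolution (R : pzRingType) (M : lmodType R) := Resolution {
  res_cpx :> complex R;
  res_aug : {linear res_cpx 0 -> M};
  res_aug_surj : forall y, exists x, res_aug x = y;
  res_aug_ker : forall x, res_aug x = 0 <-> exists z, cpx_diff res_cpx 0 z = x;
  res_exact : forall n, (0 < n)%N -> trivial_module (cpx_homology res_cpx n) }.

Section Resolutions.
Variables (R : pzRingType) (M : lmodType R).

(** The complex [... -> P_1 -> P_0 -> M -> 0] with [M] in degree 0. *)
Section Augmented.
Variable P : resolution M.
Definition augmented_mod (n : nat) : lmodType R :=
  match n with 0 => M | m.+1 => P m end.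
Definition augmented_diff n : {linear augmented_mod n.+1 -> augmented_mod n} :=
  match n with 0 => res_aug P | m.+1 => cpx_diff P m end.
Fact augmented_diffK n x : augmented_diff n (augmented_diff n.+1 x) = 0.
Proof.
case: n x => [|n] x /=; last exact: cpx_diffK.
by apply/res_aug_ker; exists x.
Qed.
Definition augmented : complex R := Complex augmented_diffK.
End Augmented.

(** The supremum is taken among the nonnegative extended integers, so that the
    zero complex has length 0. *)
Definition res_length (P : resolution M) : \bar int :=
  supremum 0%E [set (n%:Z)%:E | n in [set n | ~ trivial_module (P n)]].

Definition proj_dim : \bar int := infimum +oo%E
  [set l | exists2 P : resolution M,
             (forall n, projective_module (P n)) & res_length P = l].

End Resolutions.

(** The free resolution whose [n]th module is free on the underlying set of the
    [n]th syzygy. *)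
Section StandardResolution.
Variables (R : comNzRingType) (M : lmodType R).

Fixpoint std_syz (n : nat) : lmodType R :=
  match n with
  | 0 => M
  | m.+1 => kermod (free_lift (idfun : std_syz m -> std_syz m))
  end.

Definition std_mod n : lmodType R := {freeg (std_syz n) / R}.
Definition std_cover n : {linear std_mod n -> std_syz n} := free_lift idfun.
Definition std_incl n : {linear std_syz n.+1 -> std_mod n} :=
  (\val : kermod (std_cover n) -> std_mod n).
Definition std_diff n : {linear std_mod n.+1 -> std_mod n} :=
  std_incl n \o std_cover n.+1.

Lemma std_cover_surj n y : exists x, std_cover n x = y.
Proof. by exists << y >>; rewrite /std_cover /free_lift /= liftU scale1r. Qed.

Lemma std_inclK n x : std_cover n (std_incl n x) = 0.
Proof. by case: x => x /= xk; apply/eqP. Qed.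

Fact std_diffK n x : std_diff n (std_diff n.+1 x) = 0.
Proof.
rewrite -[LHS]/(std_incl n (std_cover n.+1 (std_incl n.+1 (std_cover n.+2 x)))).
by rewrite std_inclK linear0.
Qed.
Definition std_complex : complex R := Complex std_diffK.

Lemma std_kerP n x : std_cover n x = 0 <-> exists z, std_diff n z = x.
Proof.
split=> [/eqP xk | [z <-]]; last exact: std_inclK.
have [z zE] := std_cover_surj (KerMod xk : std_syz n.+1).
by exists z; rewrite -[LHS]/(std_incl n (std_cover n.+1 z)) zE.
Qed.

Fact std_exact n : (0 < n)%N -> trivial_module (cpx_homology std_complex n).
Proof.
case: n => // n _; apply/trivial_homologyP => y dy0; apply: (std_kerP y).1.
apply: (@val_inj _ _ (kermod (std_cover n))).
by rewrite [LHS]dy0 raddf0.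
Qed.

Definition std_resolution : resolution M :=
  @Resolution R M std_complex (std_cover 0) (std_cover_surj (n := 0))
    (std_kerP (n := 0)) std_exact.
End StandardResolution.

Section Ext.
Variables (R : comNzRingType) (M N : lmodType R).

Definition ext_in i : {linear {linear std_mod M i.-1 -> N} ->
                              {linear std_mod M i -> N}} :=
  match i with 0 => \0 | j.+1 => precomp (std_diff M j) N end.

Definition Ext i : lmodType R :=
  homology (ext_in i) (precomp (std_diff M i) N).
End Ext.

Section GDimension.
Variable R : comNzRingType.

Definition totally_reflexive (G : lmodType R) :=
  [/\ fin_gen G, bijective (biduality G),
      forall i, i != 0%N -> trivial_module (Ext G R^o i) &
      forall i, i != 0%N -> trivial_module (Ext (dual G) R^o i)].

Definition G_resolution (M : lmodType R) (P : resolution M) :=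
  forall n, totally_reflexive (P n).

Definition G_dim (M : lmodType R) : \bar int :=
  infimum +oo%E
    [set l | exists2 P : resolution M, G_resolution P & res_length P = l].

Definition proper_G_resolution (M : lmodType R) (P : resolution M) :=
  G_resolution P /\
  forall H, totally_reflexive H -> acyclic (hom_complex H (augmented P)).

(** Proper resolutions of [M] are homotopy equivalent, so [TorG] does not depend
    on the one chosen. The default value is never used when [M] has a proper
    resolution. *)
Definition choose_proper (M : lmodType R) : resolution M :=
  if pselect (exists P : resolution M, proper_G_resolution P) is left h
  then projT1 (cid h) else std_resolution M.

Definition TorG n (M N : lmodType R) : lmodType R :=
  cpx_homology (tensor_complex (choose_proper M) N) n.

(** The sequence [0 -> K -> G -> M -> 0] with maps [iota] and [p]. *)
Record G_approximation (K G M : lmodType R)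
    (iota : {linear K -> G}) (p : {linear G -> M}) : Prop := GApproximation {
  approx_finK : fin_gen K;
  approx_finG : fin_gen G;
  approx_finM : fin_gen M;
  approx_inj : injective iota;
  approx_exact : forall x, p x = 0 <-> exists y, iota y = x;
  approx_surj : forall y, exists x, p x = y;
  approx_refl : totally_reflexive G;
  approx_pd : (proj_dim K < +oo)%E }.

Definition minimal_approximation (K G : lmodType R) (iota : {linear K -> G}) :=
  forall f : chain_map (two_term iota) (two_term iota),
    homotopy_equivalence f -> chain_iso f.

End GDimension.

(** The residue field is given as a field [k] with a surjective ring morphism
    [pi : R -> k]; for local [R], the kernel of [pi] is then the maximal
    ideal. *)
Section Betti.
Variables (R : comNzRingType) (k : fieldType) (pi : {rmorphism R -> k}).

Definition residue_module of {rmorphism R -> k} : Type := k.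
Local Notation km := (residue_module pi).
HB.instance Definition _ := GRing.Zmodule.copy km k.
Definition residue_scale (a : R) (x : km) : km := (pi a * (x : k)).
Fact residue_scaleA a b x :
  residue_scale a (residue_scale b x) = residue_scale (a * b) x.
Proof. by rewrite /residue_scale rmorphM mulrA. Qed.
Fact residue_scale1 : left_id 1 residue_scale.
Proof. by move=> x; rewrite /residue_scale rmorph1 mul1r. Qed.
Fact residue_scaleDr : right_distributive residue_scale +%R.
Proof. by move=> a x y; rewrite /residue_scale mulrDr. Qed.
Fact residue_scaleDl x : {morph residue_scale^~ x : a b / a + b}.
Proof. by move=> a b; rewrite /residue_scale rmorphD mulrDl. Qed.
HB.instance Definition _ := GRing.Zmodule_isLmodule.Build R km
  residue_scaleA residue_scale1 residue_scaleDr residue_scaleDl.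

(** The dimension over [k] of an [R]-module annihilated by the kernel of [pi],
    on which [k] acts by [pi a * v = a *: v]. *)
Definition dimk (V : lmodType R) : nat :=
  xget 0%N [set d | exists f : {linear V -> 'rV[k]_d | pi \; *:%R}, bijective f].

Definition betti0 (M : lmodType R) : nat := dimk (tensor M km).

Definition G_betti n (M : lmodType R) : nat := dimk (TorG n M km).

(** Nonzero terms have [n <= G_dim M], so the sum is finite when [G_dim M] is. *)
Definition G_euler i (M : lmodType R) : int :=
  \sum_(n \in [set n : nat | (i <= n)%N]) (-1) ^+ (n - i) * (G_betti n M)%:Z.
End Betti.

(* Main.v *)
(* Splicing a minimal free resolution [F] of [K], with syzygies [Omega_n], to
   [G -> M] gives a proper G-resolution [... -> F_1 -> F_0 -> G] of [M], because
   [Ext^n(H, K) = 0] for [H] totally reflexive, [n > 0] and [K] of finite projective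
   dimension. Tensored with [k] all its differentials vanish except [F_0 -> G], so
   that [chi_i(M)] is the alternating sum of the ranks of [F_(i-1), F_i, ...] for
   [i >= 2], and [chi_1(M) - (b_0(M) - b_0(G))] is that of [F_0, F_1, ...].

   The alternating sum from [F_j] on is the rank of [Omega_j] at any prime
   [p = ann(a)], since injective maps of free modules split after localisation at
   such a [p]. A torsionless module of rank 0 at all these primes is 0, and
   [Omega_0 = K] lies in [G], [Omega_j] in [F_(j-1)]. Hence the Euler characteristics
   vanish exactly when [Omega_(i-1) = 0], resp. [K = 0]. Finally, [G-dim M < i] makes
   [Ext^n(K, R) = Ext^(n+1)(M, R)] vanish for [n >= i - 1], and the dual of the last
   map of a minimal resolution is not onto, so [Omega_(i-1) = 0]; when [G-dim M = 0]
   the same vanishing splits [K -> G], against minimality unless [K = 0]. *)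

From HB Require Import structures.
Require Import Defs.
From mathcomp Require Import all_boot all_order all_algebra.
From mathcomp Require Import boolp classical_sets fsbigop.
From mathcomp Require Import constructive_ereal.
From mathcomp Require Import freeg.
From mathcomp Require Import ring zify.

Set Implicit Arguments.
Unset Strict Implicit.
Unset Printing Implicit Defensive.

Import Order.TTheory GRing.Theory Num.Theory.
Local Open Scope ring_scope.

(** Only the vanishing of Ext is used, so [extz] expresses it by extending maps along short exact
    sequences; Schanuel's argument makes it independent of the projective cover, and no connecting
    map is built. Likewise nothing is localised: freeness at [p] is stated with elements of [R] and
    multipliers outside [p]. The obstacle is that [R] need not be a domain, so no single field of
    fractions supplies ranks. The alternating sum is one integer that is a rank at every associated
    prime at once, so a zero sum forces rank 0 at all of them. A torsion module can have only zero
    ranks without vanishing, which is why torsionless modules enter. Degree 1 is exceptional because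
    [F_0 -> G] may survive tensoring with [k]: its rank lowers the first Betti number and raises
    [b_0(G)] above [b_0(M)] by the same amount, whence the shape of (i). *)

Definition mk_linear (R : pzRingType) (U V : lmodType R) (f : U -> V)
    (lf : linear f) : {linear U -> V} :=
  HB.pack f (GRing.isLinear.Build R U V *:%R f lf).

Definition is_surj (A B : Type) (f : A -> B) := forall b, exists a, f a = b.

Record ses (R : pzRingType) (A B C : lmodType R)
    (f : {linear A -> B}) (g : {linear B -> C}) : Prop := Ses {
  ses_inj : injective f;
  ses_exact : forall x, g x = 0 <-> exists y, f y = x;
  ses_surj : is_surj g }.

(** * Linear maps, kernels and short exact sequences *)

Section LinearMaps.
Variable R : pzRingType.
Implicit Types A B C X Y P Q : lmodType R.

Lemma linear_inj0 A B (f : {linear A -> B}) :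
  (forall x, f x = 0 -> x = 0) -> injective f.
Proof.
move=> f0 x y fxy; apply/eqP; rewrite -subr_eq0; apply/eqP/f0.
by rewrite linearB fxy subrr.
Qed.

Lemma linear_factor A B C (f : {linear A -> B}) (h : {linear A -> C}) :
  is_surj f -> (forall x, f x = 0 -> h x = 0) ->
  exists u : {linear B -> C}, forall x, u (f x) = h x.
Proof.
move=> fs kh; pose s b := sval (cid (fs b)).
have sE b : f (s b) = b by rewrite /s; case: (cid _).
have hE x y : f x = f y -> h x = h y.
  move=> fxy; apply/eqP; rewrite -subr_eq0 -linearB; apply/eqP/kh.
  by rewrite linearB fxy subrr.
have lu : linear (h \o s).
  by move=> a x y; rewrite /= -linearP; apply: hE; rewrite linearP !sE.
by exists (mk_linear lu) => x; apply: hE; rewrite sE.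
Qed.

Lemma linear_corestrict A B C (f : {linear A -> B}) (h : {linear C -> B}) :
  injective f -> (forall x, exists y, f y = h x) ->
  exists u : {linear C -> A}, forall x, f (u x) = h x.
Proof.
move=> fi fh; pose s c := sval (cid (fh c)).
have sE c : f (s c) = h c by rewrite /s; case: (cid _).
have ls : linear s by move=> a x y; apply: fi; rewrite linearP !sE linearP.
by exists (mk_linear ls).
Qed.

Lemma linear_inverse A B (f : {linear A -> B}) :
  injective f -> is_surj f -> exists g : {linear B -> A}, cancel f g /\ cancel g f.
Proof.
move=> fi fs; have [|g gE] := @linear_corestrict _ _ _ f idfun fi.
  by move=> x; apply: fs.
by exists g; split=> x; [apply: fi|]; rewrite gE.
Qed.

Lemma kermodP A B (f : {linear A -> B}) (x : kermod f) : f (val x) = 0.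
Proof. by case: x => x /= kx; apply/eqP. Qed.

Definition kermod_incl A B (f : {linear A -> B}) : {linear kermod f -> A} :=
  (\val : kermod f -> A).

Lemma ker_ses A B (f : {linear A -> B}) : is_surj f -> ses (kermod_incl f) f.
Proof.
move=> fs; split=> //; first exact: val_inj.
move=> x; split=> [/eqP fx | [y <-]]; last exact: kermodP.
by exists (KerMod fx).
Qed.

Lemma ses_comp A B C (f : {linear A -> B}) (g : {linear B -> C}) :
  ses f g -> forall x, g (f x) = 0.
Proof. by move=> s x; apply/(ses_exact s); exists x. Qed.

Lemma projective_prod P Q :
  @projective_module R P -> @projective_module R Q -> projective_module (P * Q)%type.
Proof.
move=> pP pQ A B f g fs.
have linl : linear (fun x : P => g (x, 0)).
  by move=> a x y; rewrite -linearP; congr (g (_, _)); rewrite /= scaler0 addr0.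
have linr : linear (fun x : Q => g (0, x)).
  by move=> a x y; rewrite -linearP; congr (g (_, _)); rewrite /= scaler0 addr0.
have [u uE] := pP _ _ f (mk_linear linl) fs.
have [v vE] := pQ _ _ f (mk_linear linr) fs.
have lin : linear (fun x : P * Q => u x.1 + v x.2).
  by move=> a x y; rewrite !linearP scalerDr addrACA.
exists (mk_linear lin) => -[x y] /=; rewrite linearD.
move: (uE x) (vE y) => /= -> ->; rewrite -linearD; congr (g (_, _)).
  by rewrite /= addr0.
by rewrite /= add0r.
Qed.

Lemma projective_retract P Q (i : {linear P -> Q}) (r : {linear Q -> P}) :
  cancel i r -> projective_module Q -> projective_module P.
Proof.
move=> ir pQ A B f g fs.
have [h hE] := pQ _ _ f (g \o r : {linear Q -> B}) fs.
by exists (h \o i : {linear P -> A}) => x; move: (hE (i x)) => /=; rewrite ir.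
Qed.

End LinearMaps.

(** * Free modules of finite rank *)

Section RowModules.
Variable R : pzRingType.

Definition row_map n (V : lmodType R) (v : 'I_n -> V) (x : 'rV[R]_n) : V :=
  \sum_i x 0 i *: v i.
Fact row_map_linear n (V : lmodType R) (v : 'I_n -> V) : linear (row_map v).
Proof.
move=> a x y; rewrite /row_map scaler_sumr -big_split; apply: eq_bigr => i _.
by rewrite !mxE scalerDl scalerA.
Qed.
HB.instance Definition _ n (V : lmodType R) (v : 'I_n -> V) :=
  GRing.isLinear.Build R _ V *:%R (@row_map n V v) (@row_map_linear n V v).
Definition row_lift n (V : lmodType R) (v : 'I_n -> V) : {linear 'rV[R]_n -> V} :=
  row_map v.

Lemma row_lift_delta n (V : lmodType R) (v : 'I_n -> V) i :
  row_lift v (delta_mx 0 i) = v i.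
Proof.
rewrite /row_lift /= /row_map (bigD1 i) //= mxE !eqxx scale1r big1 ?addr0 //.
by move=> j ji; rewrite mxE (negbTE ji) andbF scale0r.
Qed.

Lemma linear_rowE n (V : lmodType R) (f : {linear 'rV[R]_n -> V}) x :
  f x = \sum_i x 0 i *: f (delta_mx 0 i).
Proof. by rewrite {1}[x]row_sum_delta linear_sum; apply: eq_bigr => i _; rewrite linearZ. Qed.

Lemma row_ext n (V : lmodType R) (f g : {linear 'rV[R]_n -> V}) :
  (forall i, f (delta_mx 0 i) = g (delta_mx 0 i)) -> f =1 g.
Proof.
by move=> fg x; rewrite !linear_rowE; apply: eq_bigr => i _; rewrite fg.
Qed.

Lemma row_projective n : projective_module 'rV[R]_n.
Proof.
move=> A B f g fs; pose s i := sval (cid (fs (g (delta_mx 0 i)))).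
exists (row_lift s); apply: row_ext => i.
by have /= -> := row_lift_delta s i; rewrite /s; case: (cid _).
Qed.

Lemma row_fin_gen n : fin_gen 'rV[R]_n.
Proof.
exists n, (delta_mx 0) => x; exists (x 0); exact: row_sum_delta.
Qed.

Lemma fin_genP (M : lmodType R) :
  fin_gen M <-> exists n (f : {linear 'rV[R]_n -> M}), is_surj f.
Proof.
split=> [[n [v vg]]|[n [f fs]]].
  exists n, (row_lift v) => x; have [c ->] := vg x.
  exists (\row_i c i); rewrite /row_lift /= /row_map.
  by apply: eq_bigr => i _; rewrite mxE.
exists n, (fun i => f (delta_mx 0 i)) => x; have [y <-] := fs x.
by exists (y 0); exact: linear_rowE.
Qed.

End RowModules.

(** * Vanishing of Ext and dimension shifting *)

Section Ext.
Variable R : comNzRingType.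
Implicit Types A B C X Y N H P Q : lmodType R.

Lemma std_mod_projective X n : projective_module (std_mod X n).
Proof.
move=> A B f g fs; pose s x := sval (cid (fs (g << x >>))).
have sE x : f (s x) = g << x >> by rewrite /s; case: (cid _).
exists (free_lift s) => x; elim/freeg_ind_dom0: x => [|a x D _ _ IH].
  by rewrite !linear0.
rewrite !linearD; congr (_ + _); last exact: IH.
have -> : << a *g x >> = a *: << x >> :> {freeg (std_syz X n) / R}.
  by apply/eqP/freeg_eqP=> z; rewrite coeffZ !coeffU mul1r.
rewrite !linearZ /=; congr (_ *: _).
by rewrite /free_lift /= liftU scale1r sE.
Qed.

Lemma std_ses X n : ses (std_incl X n) (std_cover X n).
Proof. exact: ker_ses (@std_cover_surj _ _ _). Qed.

Definition extends A B (f : {linear A -> B}) N :=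
  forall h : {linear A -> N}, exists u : {linear B -> N}, forall x, u (f x) = h x.

(* [Ext^1(X, N) = 0] *)
Definition ext1 X N := forall A Y (f : {linear A -> Y}) (g : {linear Y -> X}),
  ses f g -> extends f N.

(* [Ext^(n+1)(X, N) = 0] *)
Fixpoint extz n X N : Prop :=
  match n with 0 => ext1 X N | m.+1 => extz m (std_syz X 1) N end.

(** One projective cover decides. Lifting [g] along [g'] gives [l : Q -> Y] and [k : A -> A']; then
    [Y] is the pushout of [i] and [k], so [h] on [A'] and an extension [w] of [h \o k] to [Q]
    glue. *)
Lemma ext1_of_cover A Q X N (i : {linear A -> Q}) (g : {linear Q -> X}) :
  projective_module Q -> ses i g -> extends i N -> ext1 X N.
Proof.
move=> pQ sQ eQ A' Y f' g' sY h.
have [l lE] := pQ _ _ g' g (ses_surj sY).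
have [|k kE] := @linear_corestrict _ _ _ _ f' (l \o i : {linear _ -> _}) (ses_inj sY).
  move=> x; apply/(ses_exact sY); move: (lE (i x)) => /= ->; exact: ses_comp sQ x.
have [w wE] := eQ (h \o k : {linear _ -> _}).
have lin1 : linear (fun p : A' * Q => f' p.1 + l p.2).
  by move=> a x y; rewrite !linearP scalerDr addrACA.
have lin2 : linear (fun p : A' * Q => h p.1 + w p.2).
  by move=> a x y; rewrite !linearP scalerDr addrACA.
have [||u uE] := @linear_factor _ _ _ _ (mk_linear lin1) (mk_linear lin2).
- move=> y; have [q qE] := ses_surj sQ (g' y).
  have [a aE] : exists a, f' a = y - l q.
    by apply/(ses_exact sY); rewrite linearB; move: (lE q) => /= ->; rewrite qE subrr.
  by exists (a, q); rewrite /= aE subrK.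
- move=> [a q] /= e.
  have [b bE] : exists b, i b = q.
    apply/(ses_exact sQ); rewrite -lE /=.
    by rewrite -[l q](addKr (f' a)) e addr0 linearN (ses_comp sY) oppr0.
  have -> : a = - k b.
    apply: (ses_inj sY); rewrite linearN kE /= bE; apply/eqP.
    by rewrite -addr_eq0 e.
  by rewrite -bE wE /= linearN addNr.
exists u => x; have := uE (x, 0); rewrite /= !linear0 !addr0; exact.
Qed.

(** A cocycle on [std_mod X j.+1] is a map on [std_syz X j.+1], and it is a coboundary exactly when
    that map extends to [std_mod X j]. *)
Lemma ExtP X N j : trivial_module (Ext X N j.+1) <-> ext1 (std_syz X j) N.
Proof.
split=> [/trivial_homologyP tE | e1].
  apply: (ext1_of_cover (@std_mod_projective X j) (std_ses X j)) => h.
  have [|u uE] := tE (h \o std_cover X j.+1 : {linear std_mod X j.+1 -> N}).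
    apply: linear_ext => x /=; rewrite -[LHS]/(h (std_cover X j.+1 (std_diff X j.+1 x))).
    by rewrite std_inclK linear0.
  exists u => y; have [x <-] := @std_cover_surj _ _ _ y.
  exact: (congr1 (fun v : {linear std_mod X j.+1 -> N} => v x) uE).
apply/trivial_homologyP => y yd.
have [||h hE] := @linear_factor _ _ _ _ (std_cover X j.+1) y.
- exact: std_cover_surj.
- move=> x /std_kerP[z <-].
  exact: (congr1 (fun v : {linear std_mod X j.+2 -> N} => v z) yd).
have [u uE] := e1 _ _ _ _ (std_ses X j) h.
exists u; apply: linear_ext => x.
by rewrite -[LHS]/(u (std_incl X j (std_cover X j.+1 x))) uE hE.
Qed.

Lemma extz_std X N m n : extz n (std_syz X m) N <-> ext1 (std_syz X (m + n)) N.
Proof.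
elim: n m => [|n IH] m; first by rewrite addn0.
rewrite addnS -addSn; exact: (IH m.+1).
Qed.

Lemma Ext_extz X N n : trivial_module (Ext X N n.+1) <-> extz n X N.
Proof. by rewrite ExtP; rewrite -(extz_std X N 0 n). Qed.

End Ext.

Section Shift.
Variable R : comNzRingType.
Implicit Types A B C F X Y Z N H P Q : lmodType R.

(** The fibre product [Z] is given only through its projections, so that the roles of [Q] and [Q']
    can be exchanged. A lift [s : Q' -> Q] of [g'] identifies [Z] with [A + Q'], which [F + Q']
    covers with kernel [B]. *)
Lemma pullback_cover Q Q' X Z A B F (z1 : {linear Z -> Q}) (z2 : {linear Z -> Q'})
    (i : {linear A -> Q}) (g : {linear Q -> X}) (g' : {linear Q' -> X})
    (b : {linear B -> F}) (c : {linear F -> A}) :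
  (forall z, z1 z = 0 -> z2 z = 0 -> z = 0) -> (forall z, g (z1 z) = g' (z2 z)) ->
  (forall q q', g q = g' q' -> exists z, z1 z = q /\ z2 z = q') ->
  projective_module Q' -> ses i g -> ses b c ->
  exists (bb : {linear B -> (F * Q')%type}) (cc : {linear (F * Q')%type -> Z}),
    ses bb cc /\ forall x, bb x = (b x, 0).
Proof.
move=> z0 zg zs pQ' sQ sF.
have [s sE] := pQ' _ _ g g' (ses_surj sQ).
have lb : linear (fun x => (b x, 0) : (F * Q')%type).
  by move=> a x y; rewrite linearP; congr (_, _); rewrite /= scaler0 addr0.
have l1 : linear (fun p : F * Q' => i (c p.1) + s p.2).
  by move=> a x y; rewrite !linearP scalerDr addrACA.
have zex (p : F * Q') : exists z, z1 z = i (c p.1) + s p.2 /\ z2 z = p.2.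
  by apply: zs; rewrite linearD (ses_comp sQ) add0r; exact: sE.
pose w p := sval (cid (zex p)).
have w1 p : z1 (w p) = i (c p.1) + s p.2 by rewrite /w; case: (cid _) => ? [].
have w2 p : z2 (w p) = p.2 by rewrite /w; case: (cid _) => ? [].
have zinj z z' : z1 z = z1 z' -> z2 z = z2 z' -> z = z'.
  move=> e1 e2; apply/eqP; rewrite -subr_eq0; apply/eqP/z0.
    by rewrite linearB e1 subrr.
  by rewrite linearB e2 subrr.
have lw : linear w.
  move=> a x y; apply: zinj; rewrite [RHS]linearP ?w1 ?w2 //.
  by rewrite [LHS]l1.
exists (mk_linear lb), (mk_linear lw); split=> //; split=> [|p|z].
- by apply: linear_inj0 => x /= [bx]; apply: (ses_inj sF); rewrite bx linear0.
- split=> [w0|[x <-]]; last first.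
    apply: zinj; rewrite linear0 /= ?w1 ?w2 //=.
    by rewrite (ses_comp sF) !linear0 addr0.
  have p2 : p.2 = 0 by rewrite -w2; move: w0 => /= ->; rewrite linear0.
  have cp : c p.1 = 0.
    apply: (ses_inj sQ); rewrite linear0; have := w1 p; rewrite p2 linear0 addr0 => <-.
    by move: w0 => /= ->; rewrite linear0.
  have [x xE] := (ses_exact sF _).1 cp.
  by exists x => /=; rewrite xE -p2; case: p {w0 p2 cp xE}.
- have [a aE] : exists a, i a = z1 z - s (z2 z).
    by apply/(ses_exact sQ); rewrite linearB zg -sE subrr.
  have [x xE] := ses_surj sF a.
  by exists (x, z2 z); apply: zinj; rewrite /= ?w1 ?w2 //= xE aE subrK.
Qed.

(* Two projective covers of [X] have syzygies [A], [A'] with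
   [A + Q' ~ Z ~ A' + Q], [Z] the fibre product of [Q] and [Q'] over [X]. *)
Lemma schanuel_cover X A Q (i : {linear A -> Q}) (g : {linear Q -> X})
    A' Q' (i' : {linear A' -> Q'}) (g' : {linear Q' -> X})
    B F (b : {linear B -> F}) (c : {linear F -> A})
    B' F' (b' : {linear B' -> F'}) (c' : {linear F' -> A'}) :
  projective_module Q -> projective_module Q' ->
  ses i g -> ses i' g' -> ses b c -> ses b' c' ->
  exists Z (bb : {linear B -> (F * Q')%type}) (cc : {linear (F * Q')%type -> Z})
    (bb' : {linear B' -> (F' * Q)%type}) (cc' : {linear (F' * Q)%type -> Z}),
    [/\ ses bb cc, ses bb' cc', forall x, bb x = (b x, 0) & forall x, bb' x = (b' x, 0)].
Proof.
move=> pQ pQ' sQ sQ' sF sF'.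
have ld : linear (fun p : Q * Q' => g p.1 - g' p.2).
  by move=> a x y; rewrite !linearP scalerDr addrACA.
pose Z := kermod (mk_linear ld).
have l1 : linear (fun z : Z => (val z).1) by [].
have l2 : linear (fun z : Z => (val z).2) by [].
pose z1 := mk_linear l1; pose z2 := mk_linear l2.
have z0 z : z1 z = 0 -> z2 z = 0 -> z = 0.
  move=> e1 e2; apply: val_inj; rewrite raddf0; move: e1 e2 => /=.
  by case: (val z) => ? ? /= -> ->.
have zg z : g (z1 z) = g' (z2 z).
  by apply/eqP; rewrite -subr_eq0; apply/eqP; exact: (kermodP z).
have zs q q' : g q = g' q' -> exists z, z1 z = q /\ z2 z = q'.
  move=> e; have k : (q, q') \in ker_pred (mk_linear ld).
    by rewrite unfold_in /= e subrr eqxx.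
  by exists (KerMod k : Z).
have [bb [cc [? ?]]] := pullback_cover z0 zg zs pQ' sQ sF.
have z0' z : z2 z = 0 -> z1 z = 0 -> z = 0 by move=> e2 e1; exact: z0.
have zs' q q' : g' q = g q' -> exists z, z2 z = q /\ z1 z = q'.
  by move=> e; have [z []] := zs _ _ (esym e); exists z.
have [bb' [cc' [? ?]]] := pullback_cover z0' (fun z => esym (zg z)) zs' pQ sQ' sF'.
by exists Z, bb, cc, bb', cc'.
Qed.

(** In positive degree, [schanuel_cover] turns the covers of [A] and [A'] into two covers of the one
    module [Z], with their syzygies as kernels: the same statement one degree lower. *)
Lemma schanuel n X N A Q (i : {linear A -> Q}) (g : {linear Q -> X})
    A' Q' (i' : {linear A' -> Q'}) (g' : {linear Q' -> X}) :
  projective_module Q -> ses i g -> projective_module Q' -> ses i' g' ->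
  extz n A N -> extz n A' N.
Proof.
elim: n X A Q i g A' Q' i' g' => [|n IH] X A Q i g A' Q' i' g' pQ sQ pQ' sQ' eA;
  have [Z [bb [cc [bb' [cc' [sZ sZ' bbE bbE']]]]]] :=
    schanuel_cover pQ pQ' sQ sQ' (std_ses A 0) (std_ses A' 0);
  have pF := projective_prod (@std_mod_projective _ A 0) pQ';
  have pF' := projective_prod (@std_mod_projective _ A' 0) pQ; last first.
  exact: (IH _ _ _ _ _ _ _ _ _ pF sZ pF' sZ' eA).
(* [Z] is both [A] plus a projective and [A'] plus a projective, so the vanishing passes from [A]
   through [Z] to [A']. *)
have eZ : ext1 Z N.
  apply: (ext1_of_cover pF sZ) => h; have [u uE] := eA _ _ _ _ (std_ses A 0) h.
  have lu : linear (fun p : std_mod A 0 * Q' => u p.1) by move=> a x y; exact: linearP.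
  by exists (mk_linear lu) => x; rewrite bbE /= uE.
apply: (ext1_of_cover (@std_mod_projective _ A' 0) (std_ses A' 0)) => h.
have [u uE] := eZ _ _ _ _ sZ' h.
have lu : linear (fun x : std_mod A' 0 => u (x, 0)).
  by move=> a x y; rewrite -linearP; congr (u (_, _)); rewrite /= scaler0 addr0.
by exists (mk_linear lu) => x /=; rewrite -bbE' uE.
Qed.

Lemma extz_shift n X N A Q (i : {linear A -> Q}) (g : {linear Q -> X}) :
  projective_module Q -> ses i g -> extz n A N <-> extz n.+1 X N.
Proof.
move=> pQ sQ; have pS := @std_mod_projective _ X 0.
by split=> /=; [exact: schanuel pQ sQ pS (std_ses X 0) | exact: schanuel pS (std_ses X 0) pQ sQ].
Qed.

(** [P] covers itself with kernel 0, which reduces higher degrees to the zero module, and that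
    covers itself too. *)
Lemma extz_projective n P N : projective_module P -> extz n P N.
Proof.
move=> pP; have sP : ses (0 : {linear 'rV[R]_0 -> P}) (idfun : {linear P -> P}).
  split=> [x y _|x|x]; [by rewrite !thinmx0 | | by exists x].
  by split=> [/= ->|[y <-]]; first exists 0.
elim: n => [|n IH]; last apply/(extz_shift n N pP sP).
  by apply: (ext1_of_cover pP sP) => h; exists 0 => x; rewrite !thinmx0 !linear0.
have p0 := @row_projective R 0.
have s0 : ses (0 : {linear 'rV[R]_0 -> 'rV[R]_0}) (idfun : {linear 'rV[R]_0 -> 'rV[R]_0}).
  by split=> [x y _|x|x]; [rewrite !thinmx0 | rewrite (thinmx0 x); split=> // _; exists 0 | exists x].
elim: n {IH} => [|n IH]; last exact/(extz_shift n N p0 s0).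
by apply: (ext1_of_cover p0 s0) => h; exists 0 => x; rewrite !thinmx0 !linear0.
Qed.

(** Replaces the connecting map: if [P] is projective, [C'] is a syzygy of [C], and the exact
    sequence of [B'], [C'], [A] is the given one moved a step along the long exact sequence. *)
Lemma ses_rotate A B C P B' (f : {linear A -> B}) (g : {linear B -> C})
    (b : {linear B' -> P}) (c : {linear P -> B}) :
  ses f g -> ses b c ->
  exists C' (i : {linear C' -> P}) (d : {linear P -> C})
    (beta : {linear B' -> C'}) (alpha : {linear C' -> A}),
    [/\ ses i d, ses beta alpha, forall x, i (beta x) = b x &
        forall x, f (alpha x) = c (i x)].
Proof.
move=> sB sP; pose d : {linear P -> C} := g \o c.
have ds : is_surj d.
  move=> z; have [y <-] := ses_surj sB z; have [x <-] := ses_surj sP y.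
  by exists x.
have sd := ker_ses ds.
have [|beta betaE] := @linear_corestrict _ _ _ _ (kermod_incl d) b (ses_inj sd).
  by move=> x; apply/(ses_exact sd); rewrite /= (ses_comp sP) linear0.
have [|alpha alphaE] := @linear_corestrict _ _ _ _ f (c \o kermod_incl d : {linear _ -> _}) (ses_inj sB).
  by move=> x; apply/(ses_exact sB); exact: (kermodP x).
exists (kermod d), (kermod_incl d), d, beta, alpha; split=> //; split.
- by move=> x y e; apply: (ses_inj sP); rewrite -!betaE e.
- move=> x; split=> [a0|[y <-]].
    have /(ses_exact sP)[y yE] : c (kermod_incl d x) = 0.
      by rewrite -[LHS](alphaE x) a0 linear0.
    by exists y; apply: (ses_inj sd); rewrite betaE.
  apply: (ses_inj sB); rewrite alphaE linear0 -(ses_comp sP y) -betaE //.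
- move=> a; have [x xE] := ses_surj sP (f a).
  have /(ses_exact sd)[y yE] : d x = 0 by rewrite /= xE (ses_comp sB).
  by exists y; apply: (ses_inj sB); rewrite alphaE -xE -yE.
Qed.

Section LongExact.
Variable N : lmodType R.

Lemma ext1_right A B C (f : {linear A -> B}) (g : {linear B -> C}) :
  ses f g -> extends f N -> ext1 B N -> ext1 C N.
Proof.
move=> sB eA eB; have sP := std_ses B 0.
have [C' [i [d [be [al [sC sR beE alE]]]]]] := ses_rotate sB sP.
apply: (ext1_of_cover (@std_mod_projective _ B 0) sC) => h.
have [w wE] := eB _ _ _ _ sP (h \o be : {linear _ -> _}).
have [||k kE] := @linear_factor _ _ _ _ al (h \- (w \o i) : {linear _ -> _}).
- exact: (ses_surj sR).
- by move=> x /(ses_exact sR)[y <-]; rewrite /= beE wE subrr.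
have [k' k'E] := eA k.
exists (w \+ (k' \o std_cover B 0) : {linear _ -> _}) => x /=.
by rewrite -[std_cover B 0 (i x)]alE k'E kE /= addrC subrK.
Qed.

Lemma ext1_mid A B C (f : {linear A -> B}) (g : {linear B -> C}) :
  ses f g -> ext1 A N -> ext1 C N -> ext1 B N.
Proof.
move=> sB eA eC; have sP := std_ses B 0.
have [C' [i [d [be [al [sC sR beE alE]]]]]] := ses_rotate sB sP.
apply: (ext1_of_cover (@std_mod_projective _ B 0) sP) => h.
have [u uE] := eA _ _ _ _ sR h; have [v vE] := eC _ _ _ _ sC u.
by exists v => x; rewrite -beE vE uE.
Qed.

Lemma ext1_left A B C (f : {linear A -> B}) (g : {linear B -> C}) :
  ses f g -> ext1 B N -> extz 1 C N -> ext1 A N.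
Proof.
move=> sB eB eC; have sP := std_ses B 0; have pP := @std_mod_projective _ B 0.
have [C' [i [d [be [al [sC sR beE alE]]]]]] := ses_rotate sB sP.
apply: (ext1_right sR); last exact/(extz_shift 0 N pP sC).
move=> h; have [u uE] := eB _ _ _ _ sP h.
by exists (u \o i : {linear _ -> _}) => x; rewrite /= beE uE.
Qed.

(** The three exactness statements are proved together because rotation permutes them: middle
    reduces to left and left to right one degree lower, right to middle in the same degree. *)
Lemma extz_les n : forall A B C (f : {linear A -> B}) (g : {linear B -> C}), ses f g ->
  [/\ extz n A N -> extz n C N -> extz n B N,
      extz n B N -> extz n.+1 C N -> extz n A N &
      extz n A N -> extz n.+1 B N -> extz n.+1 C N].
Proof.
elim: n => [|n IH].
  move=> A B C f g sB; have sP := std_ses B 0; have pP := @std_mod_projective _ B 0.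
  have [C' [i [d [be [al [sC sR _ _]]]]]] := ses_rotate sB sP.
  split; [exact: ext1_mid sB | exact: ext1_left sB |].
  move=> eA /(extz_shift 0 N pP sP) eB; apply/(extz_shift 0 N pP sC).
  exact: ext1_mid sR eB eA.
have mid A B C (f : {linear A -> B}) (g : {linear B -> C}) :
    ses f g -> extz n.+1 A N -> extz n.+1 C N -> extz n.+1 B N.
  move=> sB eA; have sP := std_ses B 0; have pP := @std_mod_projective _ B 0.
  have [C' [i [d [be [al [sC sR _ _]]]]]] := ses_rotate sB sP.
  have [_ left _] := IH _ _ _ _ _ sR.
  by move=> /(extz_shift n N pP sC) eC; apply/(extz_shift n N pP sP); exact: left.
move=> A B C f g sB; have sP := std_ses B 0; have pP := @std_mod_projective _ B 0.
have [C' [i [d [be [al [sC sR _ _]]]]]] := ses_rotate sB sP.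
have [_ _ right] := IH _ _ _ _ _ sR.
split; first exact: mid sB.
- move=> /(extz_shift n N pP sP) eB /(extz_shift n.+1 N pP sC) eC; exact: right.
- move=> eA /(extz_shift n.+1 N pP sP) eB; apply/(extz_shift n.+1 N pP sC).
  exact: mid sR eB eA.
Qed.

Lemma extz_left n A B C (f : {linear A -> B}) (g : {linear B -> C}) :
  ses f g -> extz n B N -> extz n.+1 C N -> extz n A N.
Proof. by move=> /(extz_les n)[]. Qed.

Lemma extz_right n A B C (f : {linear A -> B}) (g : {linear B -> C}) :
  ses f g -> extz n A N -> extz n.+1 B N -> extz n.+1 C N.
Proof. by move=> /(extz_les n)[]. Qed.

End LongExact.

(** The fibre product [Y] of [F] and [H] over [B] is an extension of [H] by [A]. It splits by a
    retraction [u] onto [A], and [y.1 - f (u y)] depends only on the component of [y] in [H]. *)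
Lemma ext1_lift A F B H (f : {linear A -> F}) (g : {linear F -> B}) :
  ses f g -> ext1 H A -> forall h : {linear H -> B},
  exists l : {linear H -> F}, forall x, g (l x) = h x.
Proof.
move=> sF eH h.
have ld : linear (fun p : F * H => g p.1 - h p.2).
  by move=> a x y; rewrite !linearP scalerDr addrACA.
pose Y := kermod (mk_linear ld).
have l1 : linear (fun y : Y => (val y).1) by [].
have l2 : linear (fun y : Y => (val y).2) by [].
have yE (y : Y) : g (val y).1 = h (val y).2.
  by apply/eqP; rewrite -subr_eq0; apply/eqP; exact: (kermodP y).
have la : linear (fun a => (f a, 0) : (F * H)%type).
  by move=> a x y; rewrite linearP; congr (_, _); rewrite /= scaler0 addr0.
have [||i iE] := @linear_corestrict _ _ _ _ (kermod_incl (mk_linear ld)) (mk_linear la).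
- exact: val_inj.
- move=> a; have k : (f a, 0) \in ker_pred (mk_linear ld).
    by rewrite unfold_in /= (ses_comp sF) linear0 subrr.
  by exists (KerMod k).
have ysurj : is_surj (mk_linear l2).
  move=> x; have [y y1] := ses_surj sF (h x).
  have k : (y, x) \in ker_pred (mk_linear ld) by rewrite unfold_in /= y1 subrr.
  by exists (KerMod k : Y).
have sY : ses i (mk_linear l2).
  split=> // [x y e|y].
    by apply: (ses_inj sF); have := iE x; rewrite e iE => -[].
  split=> [/= y2|[a <-]]; last by move: (iE a) => /= ->.
  have [a aE] : exists a, f a = (val y).1 by apply/(ses_exact sF); rewrite yE y2 linear0.
  exists a; apply: val_inj; move: (iE a) => /= ->.
  have {}y2 : (val y).2 = 0 := y2.
  by rewrite aE [RHS]surjective_pairing y2.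
have [u uE] := eH _ _ _ _ sY idfun.
have lw : linear (fun y : Y => (val y).1 - f (u y)).
  by move=> a x y; rewrite !linearP scalerDr addrACA.
have [|l lE] := @linear_factor _ _ _ _ (mk_linear l2) (mk_linear lw) ysurj.
  move=> y /(ses_exact sY)[a <-] /=; rewrite uE; move: (iE a) => /= ->.
  by rewrite subrr.
exists l => x; have [y <-] := ysurj x.
by rewrite lE /= linearB (ses_comp sF) subr0 yE.
Qed.

(** The long exact sequence in the second argument: a map from a syzygy of [H] to [B] lifts to [F],
    extends there, and is composed with [g]. *)
Lemma extz_coeff n A F B H (f : {linear A -> F}) (g : {linear F -> B}) :
  ses f g -> extz n H F -> extz n.+1 H A -> extz n H B.
Proof.
move=> sF; elim: n H => [|n IH] H eF eA; last exact: IH.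
apply: (ext1_of_cover (@std_mod_projective _ H 0) (std_ses H 0)) => h.
have [l lE] := ext1_lift sF eA h.
have [u uE] := eF _ _ _ _ (std_ses H 0) l.
by exists (g \o u : {linear _ -> _}) => x; rewrite /= uE lE.
Qed.

Lemma extz_row n H r : extz n H R^o -> extz n H 'rV[R]_r.
Proof.
elim: n H => [|n IH] H eH; last exact: IH.
apply: (ext1_of_cover (@std_mod_projective _ H 0) (std_ses H 0)) => h.
have lh i : linear (fun x => h x 0 i : R^o).
  by move=> a x y; rewrite linearP !mxE.
pose u i := sval (cid (eH _ _ _ _ (std_ses H 0) (mk_linear (lh i)))).
have uE i x : u i (std_incl H 0 x) = h x 0 i by rewrite /u; case: (cid _).
have lv : linear (fun x => \row_i (u i x : R)).
  by move=> a x y; apply/rowP => i; rewrite !mxE linearP.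
by exists (mk_linear lv) => x; apply/rowP => i; rewrite !mxE uE.
Qed.

Lemma ses_iso A B (f : {linear A -> B}) :
  injective f -> is_surj f -> ses (0 : {linear 'rV[R]_0 -> A}) f.
Proof.
move=> fi fs; split=> [x y _|x|//]; first by rewrite !thinmx0.
split=> [fx|[y <-]]; last exact: linear0.
by exists 0; apply: fi; rewrite fx !linear0.
Qed.

Lemma extz_iso n A B N (f : {linear A -> B}) :
  injective f -> is_surj f -> extz n A N <-> extz n B N.
Proof.
move=> fi fs; have [g [fg gf]] := linear_inverse fi fs.
have imp X Y (u : {linear X -> Y}) : injective u -> is_surj u -> extz n X N -> extz n Y N.
  move=> ui us eX; case: n eX => [|m] eX.
    by apply: (ext1_right (ses_iso ui us)) => // h; exists 0 => x; rewrite thinmx0 !linear0.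
  apply: (extz_right (ses_iso ui us)) => //; apply: extz_projective; exact: row_projective.
split; first exact: imp fi fs.
by apply: (imp _ _ g) => [|x]; [exact: can_inj gf | exists (f x); exact: fg].
Qed.

End Shift.

(** * Noetherian local rings and minimal resolutions *)

Section InsertZero.
Variables (R : pzRingType) (n : nat) (j : 'I_n.+1).

Definition ins (y : 'rV[R]_n) : 'rV[R]_n.+1 :=
  \row_i (if unlift j i is Some i' then y 0 i' else 0).
Fact ins_linear : linear ins.
Proof.
move=> a x y; apply/rowP => i; rewrite !mxE; case: unliftP => [i' _|_]; rewrite ?mxE //.
by rewrite mulr0 addr0.
Qed.
HB.instance Definition _ := GRing.isLinear.Build R _ _ *:%R ins ins_linear.

Lemma ins_lift y i : ins y 0 (fintype.lift j i) = y 0 i.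
Proof. by rewrite mxE liftK. Qed.

Lemma ins_at y : ins y 0 j = 0.
Proof. by rewrite mxE unlift_none. Qed.

Lemma ins_col' (x : 'rV[R]_n.+1) : x 0 j = 0 -> ins (col' j x) = x.
Proof.
by move=> xj; apply/rowP => i; rewrite !mxE; case: unliftP => [i' ->|->]; rewrite ?mxE.
Qed.

Lemma ins_inj : injective ins.
Proof. by move=> x y e; apply/rowP => i; rewrite -!ins_lift e. Qed.
End InsertZero.

Section Noetherian.
Variables (R : comNzRingType) (noethR : noetherian_ring R).

(** Otherwise there is a strictly increasing chain; its union is an ideal whose finitely many
    generators already lie in one term. The index type lets a maximal ideal remember the data it
    came from. *)
Lemma noetherian_max (T : Type) (F : T -> set R) (t0 : T) :
  (forall t, is_ideal (F t)) ->
  exists t, forall u, (F t `<=` F u)%classic -> (F u `<=` F t)%classic.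
Proof.
move=> idF; apply: contrapT => /forallNP nomax.
have nxt t : exists u, (F t `<=` F u)%classic /\ ~ (F u `<=` F t)%classic.
  by have /existsNP[u /not_implyP[? ?]] := nomax t; exists u.
pose s n := iter n (fun t => sval (cid (nxt t))) t0.
have sS n : (F (s n) `<=` F (s n.+1))%classic /\ ~ (F (s n.+1) `<=` F (s n))%classic.
  by rewrite /s /=; case: (cid _).
have smono m n : (m <= n)%N -> (F (s m) `<=` F (s n))%classic.
  elim: n => [|n IH]; first by rewrite leqn0 => /eqP ->.
  rewrite leq_eqVlt ltnS => /predU1P[-> //|/IH mn x /mn].
  exact: (sS n).1.
have [|p [a aE]] := @noethR [set x | exists n, F (s n) x]%classic.
  split=> /=; first by exists 0%N; case: (idF (s 0)).
  - move=> x y [m xm] [n yn]; exists (maxn m n); case: (idF (s (maxn m n))) => _ + _.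
    by apply; [apply: smono xm; exact: leq_maxl | apply: smono yn; exact: leq_maxr].
  - by move=> b x [m xm]; exists m; case: (idF (s m)) => _ _; apply.
have an i : exists n, F (s n) (a i).
  have : [set x | exists n, F (s n) x]%classic (a i).
    rewrite aE /=; exists (fun j => (j == i)%:R).
    rewrite (bigD1 i) //= eqxx mul1r big1 ?addr0 // => j /negbTE ->.
    by rewrite mul0r.
  by [].
pose N := \max_(i < p) sval (cid (an i)).
have aN i : F (s N) (a i).
  apply: (smono (sval (cid (an i)))); last by case: (cid _).
  exact: (leq_bigmax i).
case: (sS N) => _; apply=> x xN.
have : [set x | exists n, F (s n) x]%classic x by exists N.+1.
rewrite aE => -[c ->].
case: (idF (s N)) => F0 FD FM; elim/big_ind: _ => // i _; exact: FM.
Qed.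

(** The first coordinates form a finitely generated ideal; subtracting a combination of lifts of its
    generators leaves a vector with one coordinate less. *)
Lemma row_submod_fin_gen n (S : set 'rV[R]_n) :
  S 0 -> (forall a x y, S x -> S y -> S (a *: x + y)) ->
  exists m (v : 'I_m -> 'rV[R]_n), (forall i, S (v i)) /\
    forall x, S x -> exists c : 'I_m -> R, x = \sum_i c i *: v i.
Proof.
elim: n S => [|n IH] S S0 SP.
  exists 0%N, (fun _ => 0); split=> [i //|x _]; exists (fun _ => 0).
  by rewrite big_ord0 thinmx0.
have SD x y : S x -> S y -> S (x + y) by move=> ? ?; rewrite -[x]scale1r; exact: SP.
have SZ a x : S x -> S (a *: x) by move=> ?; rewrite -[_ *: x]addr0; exact: SP.
have [|p [a aE]] := @noethR [set t | exists2 x, S x & x 0 0 = t]%classic.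
  split=> /=; first by exists 0; rewrite ?mxE.
  - by move=> _ _ [x Sx <-] [y Sy <-]; exists (x + y); rewrite ?mxE //; exact: SD.
  - by move=> b _ [x Sx <-]; exists (b *: x); rewrite ?mxE //; exact: SZ.
have ay i : exists2 x, S x & x 0 0 = a i.
  have : [set t | exists2 x, S x & x 0 0 = t]%classic (a i).
    rewrite aE /=; exists (fun j => (j == i)%:R).
    rewrite (bigD1 i) //= eqxx mul1r big1 ?addr0 // => j /negbTE ->.
    by rewrite mul0r.
  by [].
pose y i := s2val (cid2 (ay i)).
have Sy i : S (y i) by rewrite /y; case: (cid2 _).
have y0 i : y i 0 0 = a i by rewrite /y; case: (cid2 _).
have [||m [v [Sv vg]]] := IH [set z | S (ins 0 z)]%classic.
- by rewrite /= linear0.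
- by move=> b x z /= Sx Sz; rewrite linearP; exact: SP.
exists (p + m)%N, (fun i => match split i with inl i => y i | inr i => ins 0 (v i) end).
split=> [i|x Sx]; first by case: split => // ?; exact: Sv.
have : [set t | exists2 x, S x & x 0 0 = t]%classic (x 0 0) by exists x.
rewrite aE => -[c cE].
pose z := x - \sum_i c i *: y i.
have z0 : z 0 0 = 0.
  by rewrite !mxE cE summxE -sumrB big1 // => i _; rewrite mxE y0 subrr.
have Sz : S (ins 0 (col' 0 z)).
  rewrite ins_col' // /z addrC -scaleN1r; apply: SP => //.
  by elim/big_ind: _ => // i _; exact: SZ.
have [d dE] := vg _ Sz.
exists (fun i => match split i with inl i => c i | inr i => d i end).
rewrite big_split_ord /=; apply/eqP; rewrite addrC -subr_eq; apply/eqP.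
transitivity (ins 0 (col' 0 z)); last first.
  by rewrite dE linear_sum; apply: eq_bigr => i _; rewrite (unsplitK (inr i)) linearZ.
rewrite ins_col' //; congr (_ - _); apply: eq_bigr => i _.
by rewrite (unsplitK (inl i)).
Qed.

Lemma ker_row_fin_gen n (X : lmodType R) (f : {linear 'rV[R]_n -> X}) :
  fin_gen (kermod f).
Proof.
have [||m [v [Sv vg]]] := @row_submod_fin_gen n [set x | f x = 0]%classic.
- exact: linear0.
- by move=> a x y /= fx fy; rewrite linearP fx fy scaler0 addr0.
have kv i : v i \in ker_pred f by rewrite unfold_in; apply/eqP/Sv.
exists m, (fun i => KerMod (kv i)) => x; have [c cE] := vg (val x) (kermodP x).
exists c; apply: val_inj; rewrite cE -[RHS]/(kermod_incl f _) linear_sum.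
by apply: eq_bigr => i _; rewrite linearZ.
Qed.

End Noetherian.

Section Local.
Variables (R : comNzRingType) (k : fieldType) (pi : {rmorphism R -> k}).
Hypotheses (noethR : noetherian_ring R) (locR : local_ring R).
Hypothesis pi_surj : forall a : k, exists r : R, pi r = a.

Lemma ker_pi_maximal : maximal_ideal [set r | pi r = 0]%classic.
Proof.
split=> [||J [J0 JD JM] J1 kJ].
- split=> /= [|x y x0 y0|a x x0]; first exact: rmorph0.
    by rewrite rmorphD x0 y0 addr0.
  by rewrite rmorphM x0 mulr0.
- by rewrite /= rmorph1; apply/eqP/oner_neq0.
apply/seteqP; split=> // x Jx; apply: contrapT => /= /eqP px.
have [y yE] := pi_surj (pi x)^-1; apply: J1.
rewrite -(subrK (y * x) 1); apply: JD; last exact: JM.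
by apply: kJ; rewrite /= rmorphB rmorph1 rmorphM yE mulVf // subrr.
Qed.

(** A nonunit lies in a maximal ideal, found among the proper ideals containing [r]; locality
    identifies it with the kernel of [pi]. *)
Lemma local_unit r : pi r != 0 -> exists s, s * r = 1.
Proof.
move=> pr; apply: contrapT => /forallNP nr.
pose T := {I : set R | [/\ is_ideal I, ~ I 1 & I r]}.
have t0 : T.
  exists [set x | exists s, x = s * r]%classic; split; last by exists 1; rewrite mul1r.
    split=> [|_ _ [s ->] [t ->]|a _ [s ->]]; first by exists 0; rewrite mul0r.
      by exists (s + t); rewrite mulrDl.
    by exists (a * s); rewrite mulrA.
  by move=> [s /esym]; exact: nr.
have [|[I [idI I1 Ir]] /= Imax] := noetherian_max noethR (F := fun t : T => sval t) t0.
  by case=> I [].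
have Imaximal : maximal_ideal I.
  split=> // J idJ J1 IJ; apply/seteqP; split=> //.
  exact: (Imax (exist _ J (And3 idJ J1 (IJ _ Ir)))).
case: locR => I0 [_ uI0].
have : [set r | pi r = 0]%classic r by rewrite -(uI0 _ ker_pi_maximal) (uI0 _ Imaximal).
by move=> /= e; rewrite e eqxx in pr.
Qed.

Lemma min_cover (M : lmodType R) : fin_gen M ->
  exists n (f : {linear 'rV[R]_n -> M}), is_surj f /\
    forall x, f x = 0 -> forall i, pi (x 0 i) = 0.
Proof.
move=> /fin_genP[n [f fs]].
elim: n f fs => [|n IH] f fs; first by exists 0%N, f; split=> // x _ [].
have [fmin|/existsNP[x /not_implyP[fx /existsNP[i /eqP xi]]]] :=
  pselect (forall x, f x = 0 -> forall i, pi (x 0 i) = 0); first by exists n.+1, f.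
apply: (IH (f \o ins i : {linear _ -> _})) => m.
have [y yE] := fs m; have [s sE] := local_unit xi.
pose z := y - (y 0 i * s) *: x.
have z0 : z 0 i = 0 by rewrite !mxE -mulrA sE mulr1 subrr.
exists (col' i z); rewrite /= ins_col' // linearB linearZ fx.
by rewrite /= scaler0 subr0.
Qed.

(** Write [m] for the kernel of [pi]. If [M = m M], expressing the image of a basis vector of a
    minimal cover with coefficients in [m] yields a relation whose coefficient at that vector is 1
    modulo [m]. *)
Lemma nakayama (M : lmodType R) : fin_gen M ->
  (forall x : M, exists l (c : 'I_l -> R) (y : 'I_l -> M),
     (forall i, pi (c i) = 0) /\ x = \sum_i c i *: y i) ->
  trivial_module M.
Proof.
move=> /min_cover[n [f [fs fmin]]] mM.
case: n f fs fmin => [|n] f fs fmin x; first by have [y <-] := fs x; rewrite thinmx0 linear0.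
have [l [c [y [c0 yE]]]] := mM (f (delta_mx 0 0)).
pose z i := sval (cid (fs (y i))).
have zE i : f (z i) = y i by rewrite /z; case: (cid _).
have /fmin/(_ 0) : f (delta_mx 0 0 - \sum_i c i *: z i) = 0.
  rewrite linearB yE linear_sum -sumrB big1 // => i _.
  by rewrite linearZ /= zE subrr.
rewrite !mxE eqxx summxE rmorphB rmorph1 rmorph_sum big1 ?subr0.
  by move/eqP; rewrite oner_eq0.
by move=> i _; rewrite mxE rmorphM c0 mul0r.
Qed.

(** Bundling finite generation lets minimal covers be chosen by a function and iterated. *)
Record fgmod := FgMod { fg_mod :> lmodType R; fg_modP : fin_gen fg_mod }.

Fact mcover_ex (X : fgmod) : exists p : {n & {linear 'rV[R]_n -> X}},
  is_surj (projT2 p) /\ forall x, projT2 p x = 0 -> forall i, pi (x 0 i) = 0.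
Proof. by have [n [f fP]] := min_cover (fg_modP X); exists (existT _ n f). Qed.

Definition mrank (X : fgmod) : nat := projT1 (sval (cid (mcover_ex X))).
Definition mcover (X : fgmod) : {linear 'rV[R]_(mrank X) -> X} :=
  projT2 (sval (cid (mcover_ex X))).

Lemma mcover_surj X : is_surj (mcover X).
Proof. by have [] := svalP (cid (mcover_ex X)). Qed.

Lemma mcover_min X x : mcover X x = 0 -> forall i, pi (x 0 i) = 0.
Proof. by have [_] := svalP (cid (mcover_ex X)); apply. Qed.

(* Minimal syzygies; [mincl] and [mcover] give [Omega_(n+1) -> F_n -> Omega_n]. *)
Definition msyz (X : fgmod) n : fgmod :=
  iter n (fun Y => FgMod (ker_row_fin_gen noethR (mcover Y))) X.
Definition mincl X n : {linear msyz X n.+1 -> 'rV[R]_(mrank (msyz X n))} :=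
  kermod_incl (mcover (msyz X n)).

Lemma mses X n : ses (mincl X n) (mcover (msyz X n)).
Proof. exact: ker_ses (@mcover_surj _). Qed.

Lemma mincl_min X n x i : pi (mincl X n x 0 i) = 0.
Proof. exact: (mcover_min (kermodP x)). Qed.

Lemma mrank_eq0 X : mrank X = 0%N <-> trivial_module X.
Proof.
split=> [r0 x|X0].
  have [y <-] := mcover_surj x; have -> : y = 0 by apply/rowP => i; have := ltn_ord i; rewrite {2}r0.
  exact: linear0.
case: (posnP (mrank X)) => // r0.
have := @mcover_min X (delta_mx 0 (Ordinal r0)) (X0 _) (Ordinal r0).
by rewrite mxE !eqxx rmorph1 => /eqP; rewrite oner_eq0.
Qed.

Lemma msyz_trivial_le X m n : (m <= n)%N ->
  trivial_module (msyz X m) -> trivial_module (msyz X n).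
Proof.
move=> /subnK <-; elim: (n - m)%N => [//|d IH] /IH /mrank_eq0 r0 x.
apply: (ses_inj (mses X (d + m))); apply/rowP => i.
by have := ltn_ord i; rewrite {2}r0.
Qed.

(* If [Omega_(n+1) -> F_n] splits then [Omega_(n+1) = m Omega_(n+1)]. *)
Lemma msyz_split X n : extends (mincl X n) (msyz X n.+1) -> trivial_module (msyz X n.+1).
Proof.
move=> /(_ idfun)[r rE]; apply: nakayama; first exact: fg_modP.
move=> x; exists (mrank (msyz X n)), (fun i => mincl X n x 0 i).
exists (fun i => r (delta_mx 0 i)); split; first by move=> i; exact: mincl_min.
by rewrite -[LHS]/(idfun x) -rE linear_rowE.
Qed.

Lemma extz_msyz X N m n : extz n (msyz X m) N <-> extz (m + n) X N.
Proof.
elim: m n => [//|m IH] n.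
by rewrite (extz_shift n N (@row_projective R _) (mses X m)) IH addnS.
Qed.

(* The last map of a minimal resolution does not split, so its dual is not onto. *)
Lemma msyz_ext_top X n :
  trivial_module (msyz X n.+2) -> extz n X R^o -> trivial_module (msyz X n.+1).
Proof.
move=> t2 en; have e1 : extz 0 (msyz X n) R^o by apply/extz_msyz; rewrite addn0.
have r2 : mrank (msyz X n.+1) = 0%N; last exact/mrank_eq0.
case: (posnP (mrank (msyz X n.+1))) => // r0; pose i := Ordinal r0.
have ci : injective (mcover (msyz X n.+1)).
  apply: linear_inj0 => x /(ses_exact (mses X n.+1))[y <-].
  by rewrite (t2 y) linear0.
have [c' [c'K cK']] := linear_inverse ci (@mcover_surj _).
have lh : linear (fun x => c' x 0 i : R^o) by move=> a x y; rewrite linearP !mxE.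
have [u uE] := e1 _ _ _ _ (mses X n) (mk_linear lh).
have := uE (mcover (msyz X n.+1) (delta_mx 0 i)).
rewrite /= c'K mxE !eqxx linear_rowE => /(congr1 pi); rewrite rmorph1 rmorph_sum big1.
  by move/eqP; rewrite eq_sym oner_eq0.
by move=> j _; rewrite rmorphM mincl_min mul0r.
Qed.

End Local.

(** * Projective dimension and G-dimension *)

Section ExtendedIntegers.
Local Open Scope ereal_scope.
Local Open Scope classical_set_scope.

Lemma ereal_int_ltpinfty (x : \bar int) : x < +oo -> exists i : nat, (0 < i)%N /\ x < (i%:Z)%:E.
Proof.
case: x => [z _| |_] //; last by exists 1%N.
exists `|z|.+1; split=> //; rewrite lte_fin; lia.
Qed.

(** [supremum] picks a value by choice, so a least upper bound must be exhibited first: the maximum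
    of a bounded set, [+oo] otherwise. *)
Lemma supremums_nat_neq0 (A : set nat) :
  supremums [set (n%:Z)%:E | n in A] !=set0 \/ A = set0.
Proof.
have [->|A0] := eqVneq A set0; [by right | left].
have [[b bA]|/forallNP nb] := pselect (exists b, forall n, A n -> (n <= b)%N).
  have /set0P[n0 An0] := A0.
  have ex : exists n, `[< A n >] by exists n0; apply/asboolP.
  have bd n : `[< A n >] -> (n <= b)%N by move=> /asboolP; exact: bA.
  case: (ex_maxnP ex bd) => m /asboolP Am mA; exists (m%:Z)%:E; split.
    by move=> _ [n An <-]; rewrite lee_fin lez_nat; apply/mA/asboolP.
  by move=> y; apply; exists m.
exists +oo; split=> [y _|y yub]; first exact: leey.
rewrite leye_eq; case: y yub => [z|//|] yub; exfalso.
  apply: (nb `|z|%N) => n An.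
  have : (n%:Z)%:E <= z%:E by apply: yub; exists n.
  by rewrite lee_fin; lia.
have /set0P[n0 An0] := A0.
have : (n0%:Z)%:E <= -oo :> \bar int by apply: yub; exists n0.
by [].
Qed.

(** Positivity of [i] matches the convention that the empty set, hence the zero complex, has
    supremum 0. *)
Lemma supremum_nat_lt (A : set nat) (i : nat) : (0 < i)%N ->
  supremum 0 [set (n%:Z)%:E | n in A] < (i%:Z)%:E :> \bar int <->
  forall n, (i <= n)%N -> ~ A n.
Proof.
move=> i0; have [sA|->] := supremums_nat_neq0 A; last first.
  by rewrite image_set0 supremum0 lte_fin ltz_nat i0; split=> // _ n _ [].
split=> [lti n ni An|Ai].
  have : (n%:Z)%:E <= supremum 0 [set (n%:Z)%:E | n in A] :> \bar int.
    by apply: ge_supremum_Nmem => //; exists n.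
  by move=> /le_lt_trans/(_ lti); rewrite lte_fin ltz_nat ltnNge ni.
apply: (@le_lt_trans _ _ ((i.-1)%:Z)%:E); last by rewrite lte_fin; lia.
rewrite /supremum; case: ifPn => [_|_]; first by rewrite lee_fin.
case: xgetP => [y _ [_ yl]|/(_ _)]; last by case: sA => y sy /(_ y).
apply: yl => _ [n An <-]; rewrite lee_fin lez_nat -ltnS prednK //.
by rewrite ltnNge; apply/negP => /Ai.
Qed.

Lemma supremum_nat_ge0 (A : set nat) : 0 <= supremum 0 [set (n%:Z)%:E | n in A] :> \bar int.
Proof.
have [sA|->] := supremums_nat_neq0 A; last by rewrite image_set0 supremum0.
have [->|/set0P[n An]] := eqVneq A set0; first by rewrite image_set0 supremum0.
apply: (@le_trans _ _ (n%:Z)%:E); first by rewrite lee_fin.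
by apply: ge_supremum_Nmem => //; exists n.
Qed.

(** Nonnegative extended integers are well ordered, so a finite dimension is the length of an actual
    resolution. *)
Lemma infimum_attained (S : set (\bar int)) : (forall l, S l -> 0 <= l) ->
  S !=set0 -> S (infimum +oo S) /\ forall l, S l -> infimum +oo S <= l.
Proof.
move=> S0 Sn0.
have [m [Sm mS]] : exists m, S m /\ forall l, S l -> m <= l.
  have [[n0 Sn]|/forallNP nS] := pselect (exists n : nat, S (n%:Z)%:E).
    have ex : exists n : nat, `[< S (n%:Z)%:E >] by exists n0; apply/asboolP.
    case: (ex_minnP ex) => m /asboolP Sm mS; exists (m%:Z)%:E; split=> // l Sl.
    case: l Sl (S0 _ Sl) => [z|//|//] Sz.
    rewrite lee_fin => z0; rewrite lee_fin -(gez0_abs z0) lez_nat; apply: mS.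
    by apply/asboolP; rewrite gez0_abs.
  case: Sn0 => l Sl; exists l; split=> // l' Sl'.
  case: l' Sl' (S0 _ Sl') => [z|//|//] Sz; last by move=> _; exact: leey.
  by rewrite lee_fin => z0; case: (nS `|z|%N); rewrite gez0_abs.
have mi : infimums S m by split=> // y; apply.
have ie : infimum +oo S = m.
  rewrite /infimum ifF; last by apply/negbTE/set0P; exists m.
  by apply: xget_subset1 => //; exact: is_subset1_infimums.
by rewrite ie.
Qed.

Lemma infimum_lt (S : set (\bar int)) x : (forall l, S l -> 0 <= l) ->
  infimum +oo S < x <-> exists2 l, S l & l < x.
Proof.
move=> S0; have [->|/set0P Sn0] := eqVneq S set0.
  rewrite /infimum eqxx; split=> [|[] //].
  by move=> /lt_le_trans/(_ (leey x)); rewrite ltxx.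
have [Si iS] := infimum_attained S0 Sn0.
by split=> [lt|[l Sl]]; [exists (infimum +oo S) | apply: le_lt_trans; exact: iS].
Qed.

End ExtendedIntegers.

Section ResolutionSyzygies.
Variables (R : comNzRingType) (M : lmodType R).

Lemma res_length_lt (P : resolution M) (i : nat) : (0 < i)%N ->
  (res_length P < (i%:Z)%:E)%E <-> forall n, (i <= n)%N -> trivial_module (P n).
Proof.
move=> i0; rewrite /res_length supremum_nat_lt //.
by split=> [H n /H /contrapT | H n /H ? []].
Qed.

Lemma res_length_ge0 (P : resolution M) : (0 <= res_length P)%E.
Proof. exact: supremum_nat_ge0. Qed.

Lemma proj_dim_lt (i : nat) : (0 < i)%N -> (proj_dim M < (i%:Z)%:E)%E <->
  exists P : resolution M, (forall n, projective_module (P n)) /\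
    forall n, (i <= n)%N -> trivial_module (P n).
Proof.
move=> i0; rewrite infimum_lt => [|_ [P _ <-]]; last exact: res_length_ge0.
split=> [[_ [P pP <-]] /(res_length_lt P i0) | [P [pP]]]; first by exists P.
by move=> /(res_length_lt P i0) ?; exists (res_length P) => //; exists P.
Qed.

Lemma G_dim_lt (i : nat) : (0 < i)%N -> (G_dim M < (i%:Z)%:E)%E <->
  exists P : resolution M, G_resolution P /\
    forall n, (i <= n)%N -> trivial_module (P n).
Proof.
move=> i0; rewrite infimum_lt => [|_ [P _ <-]]; last exact: res_length_ge0.
split=> [[_ [P pP <-]] /(res_length_lt P i0) | [P [pP]]]; first by exists P.
by move=> /(res_length_lt P i0) ?; exists (res_length P) => //; exists P.
Qed.

Variable P : resolution M.

(** Indexed through the augmented complex: syzygy 0 is [M], as the kernel of a zero map, and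
    [res_ses] has one form in all degrees. *)
Definition res_syz n : lmodType R := kermod (cpx_out (augmented P) n).

Lemma augmented_exact n (x : augmented P n) : cpx_out (augmented P) n x = 0 ->
  exists z, cpx_diff (augmented P) n z = x.
Proof.
case: n x => [|[|n]] x /=; first by move=> _; exact: res_aug_surj.
  by move/res_aug_ker.
by move=> dx; have /trivial_homologyP := res_exact (ltn0Sn n) (r := P); apply.
Qed.

Lemma res_ses n : exists (f : {linear res_syz n.+1 -> P n}) (g : {linear P n -> res_syz n}),
  ses f g.
Proof.
pose d : {linear P n -> augmented P n} := cpx_diff (augmented P) n.
have [||g gE] := @linear_corestrict _ _ _ _ (kermod_incl (cpx_out (augmented P) n)) d.
- exact: val_inj.
- move=> x; have k : d x \in ker_pred (cpx_out (augmented P) n).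
    rewrite unfold_in; apply/eqP; case: (n) @d x => [//|m] d x.
    exact: (cpx_diffK (c := augmented P)).
  by exists (KerMod k).
exists (kermod_incl (cpx_out (augmented P) n.+1)), g; split.
- exact: val_inj.
- move=> x; split=> [gx|[y <-]].
    have k : x \in ker_pred (cpx_out (augmented P) n.+1).
      by rewrite unfold_in; apply/eqP; rewrite -[LHS](gE x) gx linear0.
    by exists (KerMod k).
  by apply: val_inj; rewrite [LHS]gE raddf0; exact: (kermodP y).
- move=> y; have [x xE] := augmented_exact (kermodP y).
  by exists x; apply: val_inj; rewrite [LHS]gE.
Qed.

Lemma res_syz_extz n N : extz n (res_syz 0) N <-> extz n M N.
Proof.
apply: (@extz_iso _ _ _ _ _ (kermod_incl (cpx_out (augmented P) 0))).
  exact: val_inj.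
move=> x; have k : x \in ker_pred (cpx_out (augmented P) 0) by rewrite unfold_in /= eqxx.
by exists (KerMod k).
Qed.

Lemma trivial_projective (X : lmodType R) : trivial_module X -> projective_module X.
Proof. by move=> X0 A B f g fs; exists \0 => x; rewrite (X0 x) !linear0. Qed.

Lemma res_syz_trivial n : trivial_module (P n) -> trivial_module (res_syz n).
Proof.
move=> P0 x; have [f [g s]] := res_ses n; have [y <-] := ses_surj s x.
by rewrite (P0 y) linear0.
Qed.

(** Downward induction from syzygy [i], which vanishes as a quotient of [P i]. *)
Lemma extz_proj_res i N n : (forall n, projective_module (P n)) ->
  trivial_module (P i) -> (i <= n)%N -> extz n M N.
Proof.
move=> pP P0 i_n; apply/res_syz_extz; rewrite -(addn0 n).
suff H m j : (j <= i)%N -> (i <= m + j)%N -> extz m (res_syz j) N by apply: H; rewrite ?addn0.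
move=> /subnK; move: (i - j)%N => d; elim: d j m => [|d IH] j m.
  move=> e _; move: e; rewrite add0n => ->.
  by apply/extz_projective/trivial_projective/res_syz_trivial.
case: m => [|m] e ij; first by move: ij; lia.
have [f [g s]] := res_ses j; apply/(extz_shift m N (pP j) s); apply: IH; lia.
Qed.

(** With coefficients [R], totally reflexive modules allow dimension shifting as projectives do. The
    bound is one better than in [extz_proj_res], and [G_dim_syz] uses this. *)
Lemma extz_Gres i n : G_resolution P -> trivial_module (P i) -> (i <= n.+1)%N ->
  extz n M R^o.
Proof.
move=> GP P0 i_n; apply/res_syz_extz.
have eP j m : extz m (P j) R^o by apply/Ext_extz; case: (GP j) => _ _ H _; exact: H.
suff H m j : (j <= i)%N -> (i <= (m + j).+1)%N -> extz m (res_syz j) R^o.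
  by apply: H; rewrite ?addn0.
move=> /subnK; move: (i - j)%N => d; elim: d j m => [|d IH] j m.
  move=> e _; move: e; rewrite add0n => ->.
  by apply/extz_projective/trivial_projective/res_syz_trivial.
have [f [g s]] := res_ses j.
(* For [m = 0] the bounds force [j.+1 = i], so [P j] maps isomorphically onto syzygy [j]. *)
case: m => [|m] e ij.
  have : trivial_module (res_syz j.+1).
    by rewrite (_ : j.+1 = i); [exact: res_syz_trivial | lia].
  move=> t; apply: (ext1_right s) => [h|]; last exact: (eP j 0%N).
  by exists \0 => x; rewrite (t x) !linear0.
apply: (extz_right s); last exact: eP.
apply: IH; lia.
Qed.

End ResolutionSyzygies.

(** If a projective resolution is 0 in degree [i], then [Ext^1(Omega_i, Omega_(i+1)) = Ext^(i+1)(X,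
    Omega_(i+1)) = 0], so the minimal resolution splits there and stops by [msyz_split]. *)
Lemma msyz_finite (R : comNzRingType) (k : fieldType) (pi : {rmorphism R -> k})
    (noethR : noetherian_ring R) (locR : local_ring R)
    (pi_surj : forall a : k, exists r : R, pi r = a) (X : fgmod R) :
  (proj_dim X < +oo)%E ->
  exists N, forall n, (N <= n)%N -> trivial_module (msyz noethR locR pi_surj X n).
Proof.
move=> /ereal_int_ltpinfty[i [i0 /(proj_dim_lt _ i0)[P [pP P0]]]].
exists i.+1 => n ni; apply: (msyz_trivial_le ni); apply: msyz_split.
have : extz 0 (msyz noethR locR pi_surj X i) (msyz noethR locR pi_surj X i.+1).
  rewrite extz_msyz addn0; exact: extz_proj_res pP (P0 i (leqnn i)) (leqnn i).
by apply; exact: mses.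
Qed.

(** * Ranks at associated primes *)

(* For a prime [p = ann(a)], "generically" means after localisation at [p]; the
   condition [s * a != 0] reads [s \notin p]. *)
Section GenericRank.
Variables (R : comNzRingType) (a : R).
Hypothesis a0 : a != 0.
Hypothesis a_prime : forall s t, s * a != 0 -> t * a != 0 -> s * t * a != 0.
Implicit Types A B : lmodType R.

Definition gen_inj A B (f : {linear A -> B}) :=
  forall x, f x = 0 -> exists s, s * a != 0 /\ s *: x = 0.
Definition gen_onto A B (f : {linear A -> B}) (x : B) :=
  exists s y, s * a != 0 /\ s *: x = f y.

(** [B] is free of rank [r] at [p]: a basis over the localisation can be rescaled to come from
    elements of [B]. *)
Definition has_rank B r := exists g : {linear 'rV[R]_r -> B},
  gen_inj g /\ forall x, gen_onto g x.

(* [h] is injective modulo [p], since [h(v) \in p R^n] gives [h(a v) = 0]. *)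
Lemma gen_inj_unit m n (h : {linear 'rV[R]_m.+1 -> 'rV[R]_n}) :
  gen_inj h -> exists j, h (delta_mx 0 0) 0 j * a != 0.
Proof.
move=> hi; apply: contrapT => /forallNP hn.
have [|s [sa /rowP/(_ 0)]] := hi (a *: delta_mx 0 0).
  rewrite linearZ; apply/rowP => j; rewrite !mxE mulrC.
  by apply/eqP; apply: contra_notT (hn j).
by rewrite !mxE !eqxx mulr1 => /eqP; rewrite (negbTE sa).
Qed.

(** Gaussian elimination at [p], with a coordinate [u] of [h(e_0)] outside [p] as pivot. Instead of
    dividing by [u] everything is multiplied by it, and [a_prime] keeps the accumulated multipliers
    outside [p]. *)
Lemma gen_rank_coker m n (h : {linear 'rV[R]_m -> 'rV[R]_n}) B (q : {linear 'rV[R]_n -> B}) :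
  gen_inj h -> (forall v, q (h v) = 0) -> (forall x, q x = 0 -> gen_onto h x) ->
  (forall x, gen_onto q x) -> exists r, (m + r)%N = n /\ has_rank B r.
Proof.
elim: m n h q => [|m IH] n h q hi qh kq qs.
  exists n; split=> //; exists q; split=> // x /kq[s [y [sa sx]]].
  by exists s; split=> //; rewrite sx thinmx0 linear0.
have [j] := gen_inj_unit hi; case: n h q hi qh kq qs j => [|n] h q hi qh kq qs; first by case.
set c := h (delta_mx 0 0) => j; set u := c 0 j => ua.
have lh : linear (fun v : 'rV[R]_m => col' j (u *: h (ins 0 v) - h (ins 0 v) 0 j *: c)).
  move=> b x y; rewrite !linearP; apply/rowP => i; rewrite !mxE; ring.
pose h' := mk_linear lh.
(* [w v] is chosen so that its image under [h] vanishes at [j]; [h' v] is that image with the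
   coordinate dropped. *)
pose w v : 'rV[R]_m.+1 := (- h (ins 0 v) 0 j) *: delta_mx 0 0 + u *: ins 0 v.
have hw v : h (w v) = u *: h (ins 0 v) - h (ins 0 v) 0 j *: c.
  by rewrite linearD !linearZ /= scaleNr addrC scalerN.
have h'E v : ins j (h' v) = h (w v).
  rewrite ins_col' ?hw // !mxE -/u; ring.
have dec (x : 'rV[R]_m.+1) : x = x 0 0 *: delta_mx 0 0 + ins 0 (col' 0 x).
  rewrite -[LHS](subrK (x 0 0 *: delta_mx 0 0)) addrC; congr (_ + _).
  rewrite -[LHS](ins_col' (j := 0)); last by rewrite !mxE eqxx mulr1 subrr.
  congr (ins _ _); apply/rowP => i; rewrite !mxE [X in (X && _)]eqxx /=.
  by rewrite mulr0 subr0.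
have [||||r [mr rB]] := IH n h' (q \o ins j : {linear _ -> _}).
- move=> v h'v; have [|s [sa sw]] := hi (w v); first by rewrite -h'E h'v linear0.
  exists (s * u); split; first exact: a_prime.
  have /(congr1 (col' 0)) := sw; rewrite linear0 => e; rewrite -e.
  by apply/rowP => i; rewrite !mxE liftK /= mulr0 add0r mulrA.
- by move=> v; rewrite -[LHS]/(q (ins j (h' v))) h'E qh.
- move=> y /kq[s [x [sa sx]]]; exists (u * s), (col' 0 x); split; first exact: a_prime.
  apply: (@ins_inj _ _ j); rewrite h'E linearZ /= -scalerA.
  have -> : s *: ins j y = h x by [].
  have xj : h x 0 j = 0 by rewrite -sx mxE ins_at mulr0.
  (* The zero coordinate at [j] determines [u * x 0 0], so that [u *: x = w (col' 0 x)]. *)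
  move: xj; rewrite {1 2}(dec x) hw linearD linearZ /= -/c !mxE -/u => xj.
  rewrite scalerDr scalerA addrC; congr (_ + _); rewrite -scaleNr; congr (_ *: _).
  by apply/eqP; rewrite -addr_eq0 mulrC xj.
- move=> b; have [s [x [sa sb]]] := qs b.
  (* Since [q c = 0], a multiple of [c] may clear the coordinate at [j]. *)
  exists (u * s), (col' j (u *: x - x 0 j *: c)); split; first exact: a_prime.
  rewrite /= ins_col'; last by rewrite !mxE -/u mulrC subrr.
  by rewrite linearB !linearZ /= -/c (qh (delta_mx 0 0)) ?oppr0 scaler0 ?subr0 ?addr0 -sb scalerA.
by exists r; split=> //; rewrite addSn mr.
Qed.

Lemma has_rank_ses A B n m (f : {linear A -> 'rV[R]_n}) (g : {linear 'rV[R]_n -> B}) :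
  ses f g -> has_rank A m -> exists r, (m + r)%N = n /\ has_rank B r.
Proof.
move=> s [h [hi hs]]; apply: (gen_rank_coker (h := f \o h : {linear _ -> _}) (q := g)).
- move=> x /= fh; apply: hi; apply: (ses_inj s); by rewrite fh linear0.
- by move=> v; exact: (ses_comp s).
- move=> x /(ses_exact s)[y <-]; have [t [z [ta tz]]] := hs y.
  by exists t, z; rewrite /= -tz linearZ.
- move=> x; have [y <-] := ses_surj s x; exists 1, y.
  by rewrite mul1r scale1r.
Qed.

Lemma has_rank_trivial B : trivial_module B -> has_rank B 0.
Proof.
move=> B0; exists \0; split=> [x _|x]; exists 1; rewrite mul1r.
  by rewrite thinmx0.
by exists 0; rewrite (B0 x) scaler0.
Qed.

End GenericRank.

Definition torsionless (R : comNzRingType) (N : lmodType R) :=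
  forall x : N, x != 0 -> exists phi : {linear N -> R^o}, phi x != 0.

(* With [ann(phi(x))] maximal among the annihilators of nonzero values of
   functionals, [a = phi(x)] has a prime annihilator and [x] is not torsion at it. *)
Lemma torsionless_rank0 (R : comNzRingType) (N : lmodType R) :
  noetherian_ring R -> torsionless N ->
  (forall a : R, a != 0 -> (forall s t, s * a != 0 -> t * a != 0 -> s * t * a != 0) ->
     has_rank a N 0) ->
  trivial_module N.
Proof.
move=> noethR tN rN x; apply: contrapT => /eqP x0.
have [phi phix] := tN x x0.
pose T := {p : N * {linear N -> R^o} | p.2 p.1 != 0}.
pose t0 : T := exist _ (x, phi) phix.
pose F (t : T) := [set s : R | s * ((sval t).2 (sval t).1 : R) = 0]%classic.
have [|[[y psi] /= a0] amax] := noetherian_max noethR (F := F) t0.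
  move=> t; split=> [|u v|u v]; rewrite /F /=; first by rewrite mul0r.
    by rewrite mulrDl => -> ->; rewrite addr0.
  by rewrite -mulrA => ->; rewrite mulr0.
pose a : R := psi y.
have pa s t : s * a != 0 -> t * a != 0 -> s * t * a != 0.
  move=> sa; apply: contraNneq => sta.
  have sy0 : psi (s *: y) != 0 by rewrite linearZ.
  apply/eqP; suff : F (exist _ (y, psi) a0) t by [].
  apply: (amax (exist _ (s *: y, psi) sy0)).
    by move=> v; rewrite /F /= linearZ /= => va; rewrite /GRing.scale /= mulrCA va mulr0.
  by rewrite /F /= linearZ /GRing.scale /= mulrA (mulrC t).
have [g [_ /(_ y)[s [z [/eqP sa sy]]]]] := rN a a0 pa.
apply: sa; rewrite -[LHS]/(s *: psi y) -linearZ sy thinmx0 !linear0 //.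
Qed.

Section SyzygyRanks.
Variables (R : comNzRingType) (k : fieldType) (pi : {rmorphism R -> k}).
Hypotheses (noethR : noetherian_ring R) (locR : local_ring R).
Hypothesis pi_surj : forall a : k, exists r : R, pi r = a.
Variables (X : fgmod R) (N : nat).
Local Notation syz := (msyz noethR locR pi_surj X).
Local Notation rk n := (mrank noethR locR pi_surj (syz n)).
Hypothesis syzN : forall n, (N <= n)%N -> trivial_module (syz n).

Definition syz_euler j : int := \sum_(j <= n < N) (-1) ^+ (n - j) * (rk n)%:Z.

Lemma syz_eulerS j : (j < N)%N -> syz_euler j = (rk j)%:Z - syz_euler j.+1.
Proof.
move=> jN; rewrite /syz_euler big_ltn // subnn mul1r -sumrN; congr (_ + _).
rewrite !big_seq; apply: eq_bigr => n; rewrite mem_index_iota => /andP[jn _].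
by rewrite -mulNr -(subnSK jn) exprS mulN1r.
Qed.

(** Downward induction from [Omega_N = 0]. The sum does not depend on [a], and being a rank it is
    nonnegative. *)
Lemma syz_euler_rank a j : a != 0 ->
  (forall s t, s * a != 0 -> t * a != 0 -> s * t * a != 0) -> (j <= N)%N ->
  exists2 r : nat, has_rank a (syz j) r & syz_euler j = r%:Z.
Proof.
move=> a0 pa /subnK; move: (N - j)%N => d; elim: d j => [|d IH] j e.
  exists 0%N; first by apply: has_rank_trivial => //; apply: syzN; rewrite -e.
  by rewrite /syz_euler big_geq // -e.
have [|m mr mE] := IH j.+1; first by rewrite addnS -addSn.
have [r [rE rr]] := has_rank_ses a0 pa (mses noethR locR pi_surj X j) mr.
by exists r => //; rewrite syz_eulerS ?mE; lia.
Qed.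

Lemma syz_euler_eq0 j : torsionless (syz j) -> syz_euler j = 0 <-> trivial_module (syz j).
Proof.
move=> tj; split=> [e0|t0].
  have [jN|/ltnW/syzN //] := leqP j N.
  apply: (torsionless_rank0 noethR tj) => a a0 pa.
  by have [r rr] := syz_euler_rank a0 pa jN; rewrite e0 => -[r0]; rewrite -r0 in rr.
rewrite /syz_euler big_seq big1 // => n; rewrite mem_index_iota => /andP[jn _].
have /mrank_eq0 -> := msyz_trivial_le jn t0; exact: mulr0.
Qed.

Lemma torsionless_sub (A : lmodType R) n (f : {linear A -> 'rV[R]_n}) :
  injective f -> torsionless A.
Proof.
move=> fi x x0; have [i xi] : exists i, f x 0 i != 0.
  apply: contrapT => /forallNP fx0; case/eqP: x0; apply: fi; rewrite linear0.
  by apply/rowP => i; rewrite mxE; apply/eqP; apply: contra_notT (fx0 i).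
have l : linear (fun x => f x 0 i : R^o) by move=> a u v; rewrite linearP !mxE.
by exists (mk_linear l).
Qed.

Lemma syz_torsionless j : torsionless (syz j.+1).
Proof. exact: torsionless_sub (ses_inj (mses noethR locR pi_surj X j)). Qed.

End SyzygyRanks.

(** * Proper G-resolutions and their comparison *)

Section RowReflexive.
Variable R : comNzRingType.

Fact row_coord_linear n (i : 'I_n) : linear (fun x : 'rV[R]_n => x 0 i : R^o).
Proof. by move=> a x y; rewrite !mxE. Qed.
Definition row_coord n (i : 'I_n) : dual 'rV[R]_n := mk_linear (row_coord_linear i).

Lemma dual_rowE n (phi : {linear 'rV[R]_n -> R^o}) :
  phi = row_lift (@row_coord n) (\row_i phi (delta_mx 0 i)) :> dual 'rV[R]_n.
Proof.
apply: linear_ext; apply: row_ext => i.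
set c := \row_i _; transitivity (eval_at (delta_mx 0 i) (row_lift (@row_coord n) c)) => //.
rewrite /row_lift /= /row_map linear_sum (bigD1 i) //= big1 ?addr0 => [|j ji].
  by rewrite /c !mxE !eqxx [RHS]mulr1.
by rewrite [X in _ *: X]mxE (negbTE ji) andbF scaler0.
Qed.

Lemma row_dual_projective n : projective_module (dual 'rV[R]_n).
Proof.
have l : linear (fun phi : dual 'rV[R]_n =>
    \row_i ((phi : {linear 'rV[R]_n -> R^o}) (delta_mx 0 i) : R)).
  by move=> a x y; apply/rowP => i; rewrite !mxE.
apply: (projective_retract (i := mk_linear l) (r := row_lift (@row_coord n))).
  by move=> phi; rewrite [RHS]dual_rowE.
exact: row_projective.
Qed.

Lemma row_biduality_bij n : bijective (biduality 'rV[R]_n).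
Proof.
have [||g [gK Kg]] := @linear_inverse _ _ _ (biduality 'rV[R]_n).
- apply: linear_inj0 => x bx; apply/rowP => i; rewrite mxE.
  exact: (congr1 (fun t : {linear dual 'rV[R]_n -> R^o} => t (row_coord i)) bx).
- move=> T; exists (\row_i ((T : {linear dual 'rV[R]_n -> R^o}) (row_coord i) : R)).
  apply: linear_ext => phi; pose T' : {linear dual 'rV[R]_n -> R^o} := T.
  pose psi : {linear 'rV[R]_n -> R^o} := phi.
  transitivity (T' (row_lift (@row_coord n) (\row_i psi (delta_mx 0 i)))).
    rewrite -[LHS]/(psi _) [LHS]linear_rowE /row_lift /= /row_map linear_sum.
    apply: eq_bigr => i _; rewrite linearZ /= !mxE; exact: mulrC.
  by rewrite -dual_rowE.
by exists g.
Qed.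

Lemma row_totally_reflexive n : totally_reflexive 'rV[R]_n.
Proof.
split; [exact: row_fin_gen | exact: row_biduality_bij | |].
  by case=> // i _; apply/Ext_extz/extz_projective; exact: row_projective.
by case=> // i _; apply/Ext_extz/extz_projective; exact: row_dual_projective.
Qed.

Lemma reflexive_torsionless (G : lmodType R) : totally_reflexive G -> torsionless G.
Proof.
case=> _ [g gK _] _ _ x x0; apply: contrapT => /forallNP n; case/eqP: x0.
apply: (can_inj gK); apply: linear_ext => phi.
transitivity ((phi : {linear G -> R^o}) x); first by [].
by rewrite linear0; apply/eqP; apply: contra_notT (n phi).
Qed.

Lemma extz_trivial_coeff n (H T : lmodType R) : trivial_module T -> extz n H T.
Proof.
move=> T0; elim: n H => [|n IH] H; last exact: IH.
by move=> A Y f g s h; exists \0 => x; rewrite (T0 (h x)).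
Qed.

End RowReflexive.

Section Approximation.
Variables (R : comNzRingType) (k : fieldType) (pi : {rmorphism R -> k}).
Hypotheses (noethR : noetherian_ring R) (locR : local_ring R).
Hypothesis pi_surj : forall a : k, exists r : R, pi r = a.
Variables (X : fgmod R) (G M : lmodType R).
Variables (iota : {linear X -> G}) (p : {linear G -> M}).
Hypotheses (sG : ses iota p) (GG : totally_reflexive G).
Hypothesis pdX : (proj_dim X < +oo)%E.
Local Notation syz := (msyz noethR locR pi_surj X).
Local Notation rk n := (mrank noethR locR pi_surj (syz n)).
Local Notation cover n := (mcover noethR locR pi_surj (syz n)).
Local Notation incl n := (mincl noethR locR pi_surj X n).
Local Notation ms n := (mses noethR locR pi_surj X n).

(** [F_m] sits in degree [m.+1]; this shift reappears in every formula for the Betti numbers. *)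
Definition apx_mod (n : nat) : lmodType R :=
  match n with 0 => G | m.+1 => 'rV[R]_(rk m) end.
Definition apx_diff n : {linear apx_mod n.+1 -> apx_mod n} :=
  match n return {linear apx_mod n.+1 -> apx_mod n} with
  | 0 => iota \o cover 0 | m.+1 => incl m \o cover m.+1 end.
Fact apx_diffK n x : apx_diff n (apx_diff n.+1 x) = 0.
Proof.
case: n x => [|n] x /=; first by rewrite (ses_comp (ms 0)) linear0.
by rewrite -[LHS]/(incl n (cover n.+1 (incl n.+1 (cover n.+2 x)))) (ses_comp (ms n.+1)) linear0.
Qed.
Definition apx_cpx : complex R := Complex apx_diffK.

Lemma apx_aug_ker x : p x = 0 <-> exists z, cpx_diff apx_cpx 0 z = x.
Proof.
split=> [/(ses_exact sG)[y <-]|[z <-]]; last exact: (ses_comp sG).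
have [z <-] := ses_surj (ms 0) y; by exists z.
Qed.

Lemma apx_exact n : (0 < n)%N -> trivial_module (cpx_homology apx_cpx n).
Proof.
case: n => // n _; apply/trivial_homologyP => y dy.
have /(ses_exact (ms n))[z <-] : cover n y = 0.
  case: n y dy => [|n] y dy.
    by apply: (ses_inj sG); rewrite [LHS]dy linear0.
  by apply: (ses_inj (ms n)); rewrite [LHS]dy linear0.
by have [w <-] := ses_surj (ms n.+1) z; exists w.
Qed.

Definition apx_res : resolution M :=
  @Resolution R M apx_cpx p (ses_surj sG) apx_aug_ker apx_exact.

Lemma apx_G_resolution : G_resolution apx_res.
Proof. by case=> [|n]; [exact: GG | exact: row_totally_reflexive]. Qed.

(** Downward induction on [j] from a vanishing syzygy, along [Omega_(j+1) -> F_j -> Omega_j] in the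
    second argument. *)
Lemma extz_syz H : totally_reflexive H -> forall j n, extz n H (syz j).
Proof.
move=> [_ _ H1 _] j n.
have [N NP] := msyz_finite noethR locR pi_surj pdX.
have [Nj|] := leqP N j; first exact/extz_trivial_coeff/NP.
move=> /ltnW/subnK; move: (N - j)%N => d; elim: d j n => [|d IH] j n e.
  by apply/extz_trivial_coeff/NP; rewrite -e.
apply: (extz_coeff (ms j)); last by apply: IH; rewrite addnS -addSn.
by apply/extz_row/Ext_extz/H1.
Qed.

Lemma apx_proper : proper_G_resolution apx_res.
Proof.
split=> [|H HH n]; first exact: apx_G_resolution.
have eH j : ext1 H (syz j) := extz_syz HH j 0.
have lift j (y : {linear H -> 'rV[R]_(rk j)}) : (forall x, cover j (y x) = 0) ->
    exists w : {linear H -> 'rV[R]_(rk j.+1)}, forall x, incl j (cover j.+1 (w x)) = y x.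
  move=> y0; have [|y' y'E] := linear_corestrict (h := y) (ses_inj (ms j)).
    by move=> x; apply/(ses_exact (ms j)).
  by have [w wE] := ext1_lift (ms j.+1) (eH j.+2) y'; exists w => x; rewrite wE.
(* Degrees 0, 1 and [n.+2] of the augmented complex hold [M], [G] and [F_n]. A cycle is a map into
   [M], [X] or [Omega_(n+1)], and lifts because [Ext^1(H, -)] vanishes on the kernel of the covering
   map. *)
apply/trivial_homologyP; case: n => [|[|n]] y y0.
- have [w wE] := ext1_lift sG (eH 0) y.
  by exists w; apply: linear_ext.
- have yk x : p (y x) = 0 := congr1 (fun t : {linear H -> M} => t x) y0.
  have [|y' y'E] := linear_corestrict (h := y) (ses_inj sG).
    by move=> x; apply/(ses_exact sG).
  have [w wE] := ext1_lift (ms 0) (eH 1) y'.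
  by exists w; apply: linear_ext => x; rewrite -y'E -wE.
- have [|w wE] := lift n y; last by exists w; exact: linear_ext.
  move=> x; case: n y y0 => [|n] y y0.
    apply: (ses_inj sG); rewrite linear0.
    exact: (congr1 (fun t : {linear H -> G} => t x) y0).
  apply: (ses_inj (ms n)); rewrite linear0.
  exact: (congr1 (fun t : {linear H -> 'rV[R]_(rk n)} => t x) y0).
Qed.

End Approximation.

(** The next term exists only thanks to the relation between the last two, as a lift needs a cycle;
    so the recursion carries related pairs. *)
Lemma dependent_sequence (T : nat -> Type) (Q : forall n, T n -> T n.+1 -> Prop)
    (x0 : T 0) (x1 : T 1) : Q 0 x0 x1 ->
  (forall n x y, Q n x y -> exists z, Q n.+1 y z) ->
  exists s : forall n, T n, s 0 = x0 /\ forall n, Q n (s n) (s n.+1).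
Proof.
move=> Q0 step.
pose U n := {p : T n * T n.+1 | Q n p.1 p.2}.
pose nxt n (u : U n) : U n.+1 :=
  exist _ ((sval u).2, sval (cid (step n _ _ (svalP u)))) (svalP (cid (step n _ _ (svalP u)))).
pose s := fix s n : U n := match n with 0 => exist _ (x0, x1) Q0 | m.+1 => nxt m (s m) end.
exists (fun n => (sval (s n)).1); split=> // n; exact: (svalP (s n)).
Qed.

Section Comparison.
Variables (R : comNzRingType) (M : lmodType R).

Lemma hom_acyclic (H : lmodType R) (D : complex R) : acyclic (hom_complex H D) ->
  (forall y : {linear H -> D 0}, exists w : {linear H -> D 1},
     forall x, cpx_diff D 0 (w x) = y x) /\
  forall n (y : {linear H -> D n.+1}), (forall x, cpx_diff D n (y x) = 0) ->
    exists w : {linear H -> D n.+2}, forall x, cpx_diff D n.+1 (w x) = y x.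
Proof.
move=> aD; split=> [y|n y y0].
  have /trivial_homologyP/(_ y erefl)[w wE] := aD 0.
  by exists w => x; exact: (congr1 (fun t : {linear H -> D 0} => t x) wE).
have /trivial_homologyP/(_ y)[|w wE] := aD n.+1; first exact: linear_ext.
by exists w => x; exact: (congr1 (fun t : {linear H -> D n.+1} => t x) wE).
Qed.

Variables P Q : resolution M.
Hypotheses (GP : G_resolution P) (pQ : proper_G_resolution Q).
Local Notation C := (augmented P).
Local Notation D := (augmented Q).

Lemma comparison_map :
  exists f : chain_map P Q, forall x, res_aug Q (f 0 x) = res_aug P x.
Proof.
have ex n := hom_acyclic (pQ.2 _ (GP n)).
have [f1 f1E] := (ex 0).1 (res_aug P).
(* Starting from the identity of [M] makes compatibility with the augmentations the first relation
   of the sequence. *)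
have [||s [s0 sE]] := @dependent_sequence (fun n => {linear C n -> D n})
  (fun n f g => forall x, f (cpx_diff C n x) = cpx_diff D n (g x)) idfun f1.
- by move=> x; rewrite f1E.
- move=> n f g fg.
  have [|w wE] := (ex n.+1).2 n (g \o cpx_diff C n.+1 : {linear _ -> _}).
    by move=> x; rewrite /= -fg (cpx_diffK (c := C)) linear0.
  by exists w => x; rewrite wE.
exists (@ChainMap _ P Q (fun n => s n.+1) (fun n => sE n.+1)) => x.
by rewrite -[LHS](sE 0) s0.
Qed.

Lemma comparison_homotopy (f g : chain_map P Q) :
  (forall x, res_aug Q (f 0 x) = res_aug Q (g 0 x)) -> homotopic f g.
Proof.
move=> fg; have ex n := hom_acyclic (pQ.2 _ (GP n)).
(* The difference [f - g], extended by 0 on [M], where the homotopy starts with 0. *)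
pose h n : {linear C n -> D n} := match n return {linear C n -> D n} with
  0 => \0 | m.+1 => f m \- g m end.
have hd n x : h n (cpx_diff C n x) = cpx_diff D n (h n.+1 x).
  case: n x => [|n] x; rewrite /= linearB; first by rewrite fg subrr.
  by rewrite !chain_comm.
have [|s1 s1E] := (ex 0).2 0 (h 1); first by move=> x; rewrite -hd.
have [||s [s0 sE]] := @dependent_sequence (fun n => {linear C n -> D n.+1})
  (fun n s t => forall x, h n.+1 x = cpx_diff D n.+1 (t x) + s (cpx_diff C n x)) \0 s1.
- by move=> x; rewrite s1E addr0.
- move=> n s t st.
  have [|w wE] := (ex n.+1).2 n.+1 (h n.+2 \- (t \o cpx_diff C n.+1) : {linear _ -> _}).
    move=> x; rewrite [LHS]linearB -hd st addrAC subrr add0r.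
    by rewrite (cpx_diffK (c := C)) linear0.
  by exists w => x; rewrite wE subrK.
exists (fun n => s n.+1) => -[|n] x /=.
  by have := sE 0 x; rewrite s0.
exact: (sE n.+1).
Qed.

End Comparison.

(** * Homotopy invariance of homology after tensoring *)

Section HomologyIso.
Variable R : comNzRingType.
Implicit Types A B C : lmodType R.

Section HomologyClass.
Variables (A B C : lmodType R) (f : {linear A -> B}) (g : {linear B -> C}).

Definition hclass (y : kermod g) : homology f g := quotmod_proj (boundary_pred f (g := g)) y.

Lemma hclass_surj q : exists y, hclass y = q.
Proof. by exists (repr q); exact: quotmod_projK. Qed.

Lemma hclass_eq y z : hclass y = hclass z <-> exists x, f x = val y - val z.
Proof.
rewrite /hclass quotmod_eqP unfold_in; split=> [/asboolP[x xE]|[x xE]].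
  by exists x; rewrite xE raddfB.
by apply/asboolP; exists x; rewrite xE raddfB.
Qed.
End HomologyClass.

Lemma homology_map A B C (A' B' C' : lmodType R) (f : {linear A -> B}) (g : {linear B -> C})
    (f' : {linear A' -> B'}) (g' : {linear B' -> C'}) (b : {linear B -> B'}) :
  (forall x, g x = 0 -> g' (b x) = 0) -> (forall x, exists y, b (f x) = f' y) ->
  exists phi : {linear homology f g -> homology f' g'},
    forall (y : kermod g) (z : kermod g'), val z = b (val y) ->
      phi (hclass f y) = hclass f' z.
Proof.
move=> bk bi.
have [|kb kbE] := linear_corestrict (f := kermod_incl g')
  (h := b \o kermod_incl g : {linear _ -> _}) val_inj.
  move=> y; have k : b (val y) \in ker_pred g' by rewrite unfold_in; apply/eqP/bk/kermodP.
  by exists (KerMod k).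
have lc : linear (fun y : kermod g => hclass f' (kb y)).
  by move=> a x y; rewrite linearP /hclass linearP.
have lh : linear (@hclass _ _ _ f g) by move=> a x y; rewrite /hclass linearP.
have [||phi phiE] := @linear_factor _ _ _ _ (mk_linear lh) (mk_linear lc).
- exact: hclass_surj.
- move=> y /= y0.
  have /hclass_eq[x xE] : hclass f y = hclass f 0 by rewrite y0 [RHS]linear0.
  have [w wE] := bi x.
  rewrite -(linear0 (mk_linear lc)) /=; apply/hclass_eq; exists w.
  rewrite -wE xE -[val (kb y)]/(kermod_incl g' (kb y)) -[val (kb 0)]/(kermod_incl g' (kb 0)).
  by rewrite !kbE /= linearB.
exists phi => y z zE; rewrite [LHS]phiE; apply/hclass_eq; exists 0.
by rewrite linear0 zE; apply/esym/eqP; rewrite subr_eq0; apply/eqP; exact: kbE.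
Qed.

Lemma homology_iso A B C (A' B' C' : lmodType R) (f : {linear A -> B}) (g : {linear B -> C})
    (f' : {linear A' -> B'}) (g' : {linear B' -> C'})
    (b : {linear B -> B'}) (b' : {linear B' -> B}) :
  (forall x, g x = 0 -> g' (b x) = 0) -> (forall x, exists y, b (f x) = f' y) ->
  (forall x, g' x = 0 -> g (b' x) = 0) -> (forall x, exists y, b' (f' x) = f y) ->
  (forall x, g x = 0 -> exists y, f y = b' (b x) - x) ->
  (forall x, g' x = 0 -> exists y, f' y = b (b' x) - x) ->
  exists phi : {linear homology f g -> homology f' g'}, bijective phi.
Proof.
move=> bk bi bk' bi' hb hb'.
have [phi phiE] := homology_map bk bi; have [psi psiE] := homology_map bk' bi'.
have kb y : g y = 0 -> b y \in ker_pred g' by move=> ?; rewrite unfold_in; apply/eqP/bk.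
have kb' y : g' y = 0 -> b' y \in ker_pred g by move=> ?; rewrite unfold_in; apply/eqP/bk'.
exists phi; exists psi => q; have [y <-] := hclass_surj q.
  have z1 := phiE y (KerMod (kb _ (kermodP y))) erefl.
  rewrite z1; have z2 := psiE (KerMod (kb _ (kermodP y))) (KerMod (kb' _ (bk _ (kermodP y)))) erefl.
  by rewrite [LHS]z2; apply/hclass_eq; exact: (hb _ (kermodP y)).
have z1 := psiE y (KerMod (kb' _ (kermodP y))) erefl.
rewrite z1; have z2 := phiE (KerMod (kb' _ (kermodP y))) (KerMod (kb _ (bk' _ (kermodP y)))) erefl.
by rewrite [LHS]z2; apply/hclass_eq; exact: (hb' _ (kermodP y)).
Qed.

Variable N : lmodType R.

Lemma tensor_map_comp A B C (D : lmodType R) (f : {linear A -> B}) (g : {linear B -> C})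
    (f' : {linear A -> D}) (g' : {linear D -> C}) :
  (forall x, g (f x) = g' (f' x)) ->
  forall x, tensor_map N g (tensor_map N f x) = tensor_map N g' (tensor_map N f' x).
Proof.
move=> e; apply: (tensor_ext (f := tensor_map N g \o tensor_map N f)
  (g := tensor_map N g' \o tensor_map N f')) => x y.
rewrite -[LHS]/(tensor_map N g (tensor_map N f (tens x y))).
rewrite -[RHS]/(tensor_map N g' (tensor_map N f' (tens x y))).
by rewrite !tensor_mapE e.
Qed.

Lemma tens0l (A : lmodType R) (y : N) : tens (0 : A) y = 0.
Proof. by apply: (addrI (tens 0 y)); rewrite -tensDl !addr0. Qed.

Lemma tens0r (A : lmodType R) (x : A) : tens x (0 : N) = 0.
Proof. by apply: (addrI (tens x 0)); rewrite -tensDr !addr0. Qed.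

(* Only positive degrees [n.+1] are treated, where the homotopy has two terms. *)
Lemma tensor_homotopy (C D : complex R) (u : chain_map C D) (v : chain_map D C) :
  homotopic (chain_comp v u) (chain_id C) -> forall n z,
  cpx_diff (tensor_complex C N) n z = 0 ->
  exists y, cpx_diff (tensor_complex C N) n.+1 y =
    tensor_map N (v n.+1) (tensor_map N (u n.+1) z) - z.
Proof.
move=> [s sE] n z dz; exists (tensor_map N (s n.+1) z).
have e : tensor_map N (v n.+1) \o tensor_map N (u n.+1) =1
    (idfun \+ (tensor_map N (cpx_diff C n.+1) \o tensor_map N (s n.+1)))
      \+ (tensor_map N (s n) \o tensor_map N (cpx_diff C n)).
  apply: (tensor_ext (f := tensor_map N (v n.+1) \o tensor_map N (u n.+1))
    (g := (idfun \+ (tensor_map N (cpx_diff C n.+1) \o tensor_map N (s n.+1)))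
      \+ (tensor_map N (s n) \o tensor_map N (cpx_diff C n)))) => x y.
  rewrite -[LHS]/(tensor_map N (v n.+1) (tensor_map N (u n.+1) (tens x y))).
  rewrite -[RHS]/(tens x y + tensor_map N (cpx_diff C n.+1) (tensor_map N (s n.+1) (tens x y))
    + tensor_map N (s n) (tensor_map N (cpx_diff C n) (tens x y))).
  rewrite !tensor_mapE -!tensDl; congr (tens _ _).
  by have /eqP := sE n.+1 x; rewrite subr_eq /= => /eqP ->; rewrite addrC addrA.
rewrite -[X in _ = X - _]/((tensor_map N (v n.+1) \o tensor_map N (u n.+1)) z) e.
rewrite -[LHS]/(tensor_map N (cpx_diff C n.+1) (tensor_map N (s n.+1) z)).
rewrite -[X in X - _]/(z + tensor_map N (cpx_diff C n.+1) (tensor_map N (s n.+1) z)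
  + tensor_map N (s n) (tensor_map N (cpx_diff C n) z)).
have -> : tensor_map N (cpx_diff C n) z = 0 by exact: dz.
by rewrite linear0 addr0 [X in X - _]addrC addrK.
Qed.

Lemma tensor_homology_iso (C D : complex R) (u : chain_map C D) (v : chain_map D C) n :
  homotopic (chain_comp v u) (chain_id C) -> homotopic (chain_comp u v) (chain_id D) ->
  exists phi : {linear cpx_homology (tensor_complex C N) n.+1 ->
                       cpx_homology (tensor_complex D N) n.+1}, bijective phi.
Proof.
move=> huv hvu.
apply: (homology_iso (b := tensor_map N (u n.+1)) (b' := tensor_map N (v n.+1))).
- move=> x dx; have <- := tensor_map_comp (fun x => chain_comm u x) x.
  by rewrite [X in tensor_map _ _ X]dx linear0.
- move=> x; exists (tensor_map N (u n.+2) x).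
  exact: (tensor_map_comp (fun x => chain_comm u x)).
- move=> x dx; have <- := tensor_map_comp (fun x => chain_comm v x) x.
  by rewrite [X in tensor_map _ _ X]dx linear0.
- move=> x; exists (tensor_map N (v n.+2) x).
  exact: (tensor_map_comp (fun x => chain_comm v x)).
- exact: tensor_homotopy huv n.
- exact: tensor_homotopy hvu n.
Qed.

Lemma TorG_proper (M : lmodType R) (P : resolution M) n : proper_G_resolution P ->
  exists phi : {linear TorG n.+1 M N -> cpx_homology (tensor_complex P N) n.+1},
    bijective phi.
Proof.
move=> pP; have pC : proper_G_resolution (choose_proper M).
  by rewrite /choose_proper; case: pselect => [h|[]]; [case: (cid h) | exists P].
have [u uE] := comparison_map pC.1 pP; have [v vE] := comparison_map pP.1 pC.
apply: (tensor_homology_iso (u := u) (v := v)).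
  by apply: (comparison_homotopy pC.1 pC) => x; rewrite /= vE uE.
by apply: (comparison_homotopy pP.1 pP) => x; rewrite /= uE vE.
Qed.

End HomologyIso.

(** * Dimensions over the residue field *)

Section ResidueDimension.
Variables (R : comNzRingType) (k : fieldType) (pi : {rmorphism R -> k}).
Hypothesis pi_surj : forall a : k, exists r : R, pi r = a.
Implicit Types U V W X : lmodType R.

Definition semilinear V n (f : V -> 'rV[k]_n) :=
  forall a x y, f (a *: x + y) = pi a *: f x + f y.

(** [dimk] picks a value by choice; this relation is what can be transported and computed with
    before [has_dim_dimk] fixes that value. *)
Definition has_dim V n := exists f : V -> 'rV[k]_n,
  [/\ semilinear f, injective f & is_surj f].

Lemma semilinear0 V n (f : V -> 'rV[k]_n) : semilinear f -> f 0 = 0.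
Proof.
by move=> fl; have := fl (-1) 0 0; rewrite scaler0 addr0 rmorphN1 scaleN1r addNr.
Qed.

Lemma semilinear_inverse V n (f : V -> 'rV[k]_n) :
  semilinear f -> injective f -> is_surj f ->
  exists g : 'rV[k]_n -> V, [/\ cancel f g, cancel g f &
    forall a r x y, pi r = a -> g (a *: x + y) = r *: g x + g y].
Proof.
move=> fl fi fs; pose g x := sval (cid (fs x)).
have gK x : f (g x) = x by rewrite /g; case: (cid _).
exists g; split=> [x|//|a r x y <-]; apply: fi; by rewrite ?fl !gK.
Qed.

Lemma has_dim_le V m n : has_dim V m -> has_dim V n -> (m <= n)%N.
Proof.
move=> [f [fl fi fs]] [g [gl gi gs]].
have [f' [fK f'K f'l]] := semilinear_inverse fl fi fs.
have [g' [gK g'K g'l]] := semilinear_inverse gl gi gs.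
have l1 : linear (g \o f').
  by move=> a x y; have [r rE] := pi_surj a; rewrite /= (f'l _ _ _ _ rE) gl rE.
have l2 : linear (f \o g').
  by move=> a x y; have [r rE] := pi_surj a; rewrite /= (g'l _ _ _ _ rE) fl rE.
apply: (@mulmx1_min _ _ _ (lin1_mx (mk_linear l1)) (lin1_mx (mk_linear l2))).
apply/row_matrixP => i; rewrite !rowE mulmxA !mul_rV_lin1 /= gK f'K.
by rewrite mulmx1.
Qed.

Lemma has_dim_dimk V n : has_dim V n -> dimk pi V = n.
Proof.
move=> dV; have dE f : [set d | exists f : {linear V -> 'rV[k]_d | pi \; *:%R}, bijective f]%classic f <-> has_dim V f.
  split=> [[h [g hK gK]]|[h [hl hi hs]]].
    exists h; split=> [a x y||x]; [exact: linearP | exact: can_inj hK | by exists (g x)].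
  have [g [hK gK _]] := semilinear_inverse hl hi hs.
  exists (HB.pack h (GRing.isLinear.Build R V 'rV[k]_f (pi \; *:%R) h hl) :
    {linear V -> 'rV[k]_f | pi \; *:%R}).
  by exists g.
rewrite /dimk; case: xgetP => [d _ /dE dV'|/(_ n) []]; last exact/dE.
by apply/eqP; rewrite eqn_leq !(has_dim_le dV') ?(has_dim_le dV).
Qed.

Lemma has_dim_bij V W (f : {linear V -> W}) n : bijective f -> has_dim W n -> has_dim V n.
Proof.
move=> [g fK gK] [h [hl hi hs]]; exists (h \o f); split=> [a x y|x y /hi|y].
- by rewrite /= linearP hl.
- exact: (can_inj fK).
- by have [w wE] := hs y; exists (g w); rewrite /= gK.
Qed.

(** [r] is the rank of the matrix of [phi]; [U] is matched with its kernel and [X] with its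
    cokernel. *)
Lemma has_dim_exact4 U V W X n m (j : {linear U -> V}) (phi : {linear V -> W})
    (q : {linear W -> X}) :
  has_dim V n -> has_dim W m -> injective j -> is_surj q ->
  (forall v, phi v = 0 <-> exists u, j u = v) ->
  (forall w, q w = 0 <-> exists v, phi v = w) ->
  exists r, [/\ (r <= n)%N, (r <= m)%N, has_dim U (n - r) & has_dim X (m - r)].
Proof.
move=> [cV [lV iV sV]] [cW [lW iW sW]] ji qs jE qE.
have [cV' [VK KV lV']] := semilinear_inverse lV iV sV.
have lh : linear (fun x => cW (phi (cV' x))).
  by move=> a x y; have [r rE] := pi_surj a; rewrite (lV' _ _ _ _ rE) linearP lW rE.
pose A := lin1_mx (mk_linear lh).
have AE v : cW (phi v) = cV v *m A by rewrite mul_rV_lin1 /= VK.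
exists (\rank A); rewrite rank_leq_row rank_leq_col; split=> //.
  rewrite -mxrank_ker; set B := row_base (kermx A).
  have jB u : (cV (j u) <= B)%MS.
    rewrite eq_row_base; apply/sub_kermxP; rewrite -AE.
    by rewrite (_ : phi _ = 0) ?(semilinear0 lW) //; apply/jE; exists u.
  have BK u : cV (j u) *m pinvmx B *m B = cV (j u) by rewrite mulmxKpV.
  exists (fun u => cV (j u) *m pinvmx B); split=> [a x y|x y e|y].
  - by rewrite linearP lV mulmxDl -scalemxAl.
  - by apply/ji/iV; rewrite -BK e BK.
  - have [v vE] := sV (y *m B).
    have /jE[u uE] : phi v = 0.
      apply: iW; rewrite AE vE (semilinear0 lW); apply/sub_kermxP.
      by apply: submx_trans (submxMl _ _) _; rewrite eq_row_base.
    by exists u; rewrite uE vE -mulmxA mulmxVp ?mulmx1 // row_base_free.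
rewrite -mxrank_coker; set B := col_base (cokermx A).
pose s x := sval (cid (qs x)).
have sK x : q (s x) = x by rewrite /s; case: (cid _).
have AB : A *m B = 0.
  apply: (row_free_inj (row_base_free (cokermx A))); rewrite /= mul0mx -mulmxA.
  by rewrite mulmx_base mulmx_coker.
have fE w w' : q w = q w' -> cW w *m B = cW w' *m B.
  move=> e; have /qE[v vE] : q (w - w') = 0 by rewrite linearB e subrr.
  have -> : w = 1 *: phi v + w' by rewrite scale1r vE subrK.
  by rewrite lW rmorph1 scale1r AE mulmxDl -mulmxA AB mulmx0 add0r.
exists (fun x => cW (s x) *m B); split=> [a x y|x y e|y].
- rewrite scalemxAl -mulmxDl -lW; apply: fE.
  by rewrite linearP !sK.
- apply/eqP; rewrite -subr_eq0 -(sK x) -(sK y) -linearB; apply/eqP/qE.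
  have : (cW (s x - s y) <= A)%MS.
    rewrite submxE -(mulmx_base (cokermx A)) mulmxA -/B.
    have -> : s x - s y = (-1) *: s y + s x by rewrite scaleN1r addrC.
    by rewrite lW rmorphN1 scaleN1r mulmxDl mulNmx e addNr mul0mx.
  move=> /submxP[D DE]; have [v vE] := sV D; exists v.
  by apply: iW; rewrite AE vE -DE.
- have [w wE] := sW (y *m pinvmx B); exists (q w).
  rewrite (fE _ w) ?sK // wE mulmxKpV // submx_full //.
  exact: col_base_full.
Qed.

End ResidueDimension.

(** * Right exactness of the tensor product and reduction to the residue field *)

Section TensorExact.
Variables (R : comNzRingType) (N : lmodType R).
Implicit Types A B C : lmodType R.

Lemma tensor_ind A (P : tensor A N -> Prop) :
  P 0 -> (forall a x y z, P z -> P (a *: tens x y + z)) -> forall z, P z.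
Proof.
move=> P0 PS q; rewrite -[q]quotmod_projK; elim/freeg_ind_dom0: (repr _).
  by rewrite linear0.
move=> a [x y] D _ _ IH; rewrite linearD.
have -> : << a *g (x, y) >> = a *: << (x, y) >> :> {freeg (A * N) / R}.
  by apply/eqP/freeg_eqP=> z; rewrite coeffZ !coeffU mul1r.
rewrite linearZ; exact: PS.
Qed.

Lemma tensor_map_surj A B (f : {linear A -> B}) : is_surj f -> is_surj (tensor_map N f).
Proof.
move=> fs; apply: tensor_ind => [|a x y _ [w <-]]; first by exists 0; rewrite linear0.
have [x' <-] := fs x; exists (a *: tens x' y + w).
by rewrite linearP tensor_mapE.
Qed.

(** A set-theoretic section of [g] defines a map from [tensor C N] to the cokernel of
    [tensor_map N f], bilinear because preimages differ by values of [f]. After [tensor_map N g] it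
    is the projection, which bounds the kernel. *)
Lemma tensor_right_exact A B C (f : {linear A -> B}) (g : {linear B -> C}) :
  is_surj g -> (forall x, g x = 0 <-> exists y, f y = x) ->
  forall z, tensor_map N g z = 0 <-> exists w, tensor_map N f w = z.
Proof.
move=> gs gE.
have gf x : g (f x) = 0 by apply/gE; exists x.
move=> z; split=> [|[w <-]]; last first.
  rewrite (tensor_map_comp (f' := \0) (g' := g)) => [|x]; last by rewrite gf linear0.
  have -> : tensor_map N (\0 : {linear A -> B}) w = 0; last exact: linear0.
  apply: (tensor_ext (f := tensor_map N \0) (g := \0)) => x y.
  by rewrite tensor_mapE tens0l.
(* The cokernel is written as a homology with zero outgoing map. *)
pose T := tensor B N; pose zero : {linear T -> 'rV[R]_0} := \0.
pose Q := homology (tensor_map N f) zero.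
have kz t : t \in ker_pred zero by rewrite unfold_in eqxx.
pose ka t : Q := hclass (tensor_map N f) (KerMod (kz t)).
have kal : linear ka.
  move=> a x y; rewrite /ka /hclass -linearP; congr quotmod_proj; exact: val_inj.
have ka0 t : ka t = 0 <-> exists w, tensor_map N f w = t.
  have k0 : ka 0 = 0 := linear0 (mk_linear kal).
  rewrite -k0; split=> [/hclass_eq[w]|[w wE]]; first by rewrite subr0; exists w.
  by apply/hclass_eq; exists w; rewrite subr0.
pose s c := sval (cid (gs c)).
have sK c : g (s c) = c by rewrite /s; case: (cid _).
pose KA := mk_linear kal.
have kaE b b' n : g b = g b' -> KA (tens b n) = KA (tens b' n).
  move=> e; have /gE[y yE] : g (b - b') = 0 by rewrite linearB e subrr.
  have -> : b = f y + b' by rewrite yE subrK.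
  rewrite tensDl linearD -[RHS]add0r; congr (_ + _).
  by apply/ka0; exists (tens y n); rewrite tensor_mapE.
have bl n : linear (fun c => KA (tens (s c) n)).
  move=> a x y; rewrite -linearP -tensZl -tensDl; apply: kaE.
  by rewrite linearP !sK.
have br c : linear (fun n => KA (tens (s c) n)).
  by move=> a x y; rewrite -linearP -tensZr -tensDr.
pose L := tensor_lift bl br.
have LE t : L (tensor_map N g t) = KA t.
  apply: (tensor_ext (f := L \o tensor_map N g) (g := KA)) => x n.
  rewrite -[LHS]/(L (tensor_map N g (tens x n))) tensor_mapE tensor_liftE.
  by apply: kaE; rewrite sK.
by move=> z0; apply/ka0; rewrite -[LHS]/(KA z) -LE z0 linear0.
Qed.

End TensorExact.

Section ResidueTensor.
Variables (R : comNzRingType) (k : fieldType) (pi : {rmorphism R -> k}).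
Hypothesis noethR : noetherian_ring R.
Hypothesis pi_surj : forall a : k, exists r : R, pi r = a.
Local Notation km := (residue_module pi).

Lemma row_tens n (x : 'rV[R]_n) (y : km) :
  tens x y = \sum_i tens (delta_mx 0 i) (x 0 i *: y).
Proof.
have l : linear (fun x : 'rV[R]_n => tens x y) by move=> a u v; rewrite tensDl tensZl.
rewrite -[LHS]/(mk_linear l x) linear_rowE; apply: eq_bigr => i _.
by rewrite tensZr.
Qed.

Lemma row_tensor_dim n : has_dim pi (tensor 'rV[R]_n km) n.
Proof.
have bl (y : km) : linear (fun x : 'rV[R]_n => [ffun i : 'I_n => x 0 i *: y]).
  by move=> a u v; apply/ffunP => i; rewrite !ffunE !mxE scalerDl scalerA.
have br (x : 'rV[R]_n) : linear (fun y : km => [ffun i : 'I_n => x 0 i *: y]).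
  by move=> a u v; apply/ffunP => i; rewrite !ffunE scalerDr !scalerA mulrC.
pose L := tensor_lift bl br.
have LE x y i : L (tens x y) i = x 0 i *: y by rewrite tensor_liftE ffunE.
have lS : linear (fun z => \sum_i tens (delta_mx 0 i : 'rV[R]_n) (L z i)).
  move=> a u v; rewrite scaler_sumr -big_split; apply: eq_bigr => i _.
  by rewrite linearP !ffunE tensDr tensZr.
have LK z : \sum_i tens (delta_mx 0 i) (L z i) = z.
  apply: (tensor_ext (f := mk_linear lS) (g := idfun)) => x y /=.
  by rewrite [RHS]row_tens; apply: eq_bigr => i _; rewrite LE.
exists (fun z => \row_i (L z i : k)); split=> [a x y|x y e|y].
- by apply/rowP => i; rewrite !mxE linearP !ffunE.
- rewrite -[x]LK -[y]LK; apply: eq_bigr => i _.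
  by move/rowP/(_ i): e; rewrite !mxE => ->.
- exists (\sum_i tens (delta_mx 0 i) (y 0 i : km)); apply/rowP => j.
  rewrite mxE linear_sum sum_ffunE (bigD1 j) //= big1 => [|i ij].
    by rewrite LE mxE !eqxx scale1r addr0.
  by rewrite LE mxE eq_sym (negbTE ij) andbF scale0r.
Qed.

Lemma fin_gen_tensor_dim (G : lmodType R) : fin_gen G -> exists n, has_dim pi (tensor G km) n.
Proof.
move=> /fin_genP[n [f fs]].
have /fin_genP[m [g gs]] := ker_row_fin_gen noethR f.
pose h : {linear 'rV[R]_m -> 'rV[R]_n} := kermod_incl f \o g.
have [||r [_ _ _ dG]] := has_dim_exact4 pi_surj
    (j := kermod_incl (tensor_map km h)) (phi := tensor_map km h) (q := tensor_map km f)
    (row_tensor_dim m) (row_tensor_dim n) val_inj (tensor_map_surj fs).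
- move=> v; split=> [hv|[u <-]]; last exact: (kermodP u).
  have hk : v \in ker_pred (tensor_map km h) by rewrite unfold_in; apply/eqP.
  by exists (KerMod hk).
- apply: tensor_right_exact => // x; rewrite (ses_exact (ker_ses fs)).
  split=> [[y <-]|[y <-]]; last by exists (g y).
  by have [z <-] := gs y; exists z.
by exists (n - r)%N.
Qed.

Lemma tensor_map_residue0 (A : lmodType R) n (f : {linear A -> 'rV[R]_n}) :
  (forall x i, pi (f x 0 i) = 0) -> forall z, tensor_map km f z = 0.
Proof.
move=> f0; apply: (tensor_ext (f := tensor_map km f) (g := \0)) => x y.
rewrite tensor_mapE row_tens big1 // => i _.
by rewrite (_ : _ *: y = 0) ?tens0r // /GRing.scale /= /residue_scale f0 mul0r.
Qed.

(** Without boundaries homology is the module of cycles, embedded here in [B] to fit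
    [has_dim_exact4]. *)
Lemma homology_no_boundary (A B C : lmodType R) (f : {linear A -> B}) (g : {linear B -> C}) :
  (forall x, f x = 0) ->
  exists j : {linear homology f g -> B}, injective j /\
    forall y, g y = 0 <-> exists q, j q = y.
Proof.
move=> f0.
have lh : linear (@hclass _ _ _ _ f g) by move=> a x y; rewrite /hclass linearP.
have [||j jE] := @linear_factor _ _ _ _ (mk_linear lh) (kermod_incl g).
- exact: hclass_surj.
- move=> y /= y0; have /hclass_eq[x] : hclass f y = hclass f 0.
    by rewrite y0 [RHS](linear0 (mk_linear lh)).
  rewrite f0 => e; have : kermod_incl g y - kermod_incl g 0 = 0 by [].
  by rewrite linear0 subr0.
exists j; split=> [|y].
  apply: linear_inj0 => q; have [y <-] := hclass_surj q; rewrite [j _]jE => y0.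
  by rewrite (_ : y = 0) ?[LHS](linear0 (mk_linear lh)) //; apply: val_inj; rewrite raddf0.
split=> [gy|[q <-]].
  have hk : y \in ker_pred g by rewrite unfold_in; apply/eqP.
  by exists (hclass f (KerMod hk)); rewrite [LHS]jE.
by have [y' <-] := hclass_surj q; rewrite [j _]jE; exact: (kermodP y').
Qed.

End ResidueTensor.

(** * Relative Betti numbers *)

Section GBetti.
Variables (R : comNzRingType) (k : fieldType) (pi : {rmorphism R -> k}).
Hypotheses (noethR : noetherian_ring R) (locR : local_ring R).
Hypothesis pi_surj : forall a : k, exists r : R, pi r = a.
Variables (X : fgmod R) (G M : lmodType R).
Variables (iota : {linear X -> G}) (p : {linear G -> M}).
Hypotheses (sG : ses iota p) (GG : totally_reflexive G).
Hypothesis pdX : (proj_dim X < +oo)%E.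
Local Notation syz := (msyz noethR locR pi_surj X).
Local Notation rk n := (mrank noethR locR pi_surj (syz n)).
Local Notation apx := (apx_res noethR locR pi_surj sG).
Local Notation km := (residue_module pi).

Lemma G_betti_apx n d :
  has_dim pi (cpx_homology (tensor_complex apx km) n.+1) d -> G_betti pi n.+1 M = d.
Proof.
move=> dn; have [phi phib] := TorG_proper km n (apx_proper noethR locR pi_surj sG GG pdX).
have dT := has_dim_bij phib dn.
exact: (has_dim_dimk pi_surj dT).
Qed.

(** Both neighbouring differentials vanish over [k] by minimality. This begins in degree 2, since
    [F_0 -> G] need not vanish. *)
Lemma G_betti_syz n : G_betti pi n.+2 M = rk n.+1.
Proof.
apply: G_betti_apx.
have z m x : tensor_map km (apx_diff noethR locR pi_surj iota m.+1) x = 0.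
  apply: tensor_map_residue0 => y i; exact: mincl_min.
have [j [ji jE]] := homology_no_boundary
  (tensor_map km (apx_diff noethR locR pi_surj iota n.+1)) (z n.+1).
apply: (has_dim_bij (f := j)); last exact: row_tensor_dim.
have [|g [gK Kg]] := linear_inverse ji; last by exists g.
by move=> y; apply/jE; exact: z.
Qed.

(** [r] is the rank over [k] of [F_0 -> G]: after tensoring, this map has kernel [Tor_1] and
    cokernel that of [M]. *)
Lemma G_betti1 : exists r, [/\ (r <= rk 0)%N, G_betti pi 1 M = (rk 0 - r)%N &
  betti0 pi G = (betti0 pi M + r)%N].
Proof.
pose d0 := apx_diff noethR locR pi_surj iota 0.
have z x : tensor_map km (apx_diff noethR locR pi_surj iota 1) x = 0.
  apply: tensor_map_residue0 => y i; exact: mincl_min.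
have [j [ji jE]] := homology_no_boundary (tensor_map km d0) z.
have finG : fin_gen G by case: GG.
have [g dG] := fin_gen_tensor_dim noethR pi_surj finG.
have ps := ses_surj sG.
have [|r [rn rg dH dM]] := has_dim_exact4 pi_surj (row_tensor_dim pi (rk 0)) dG ji
    (tensor_map_surj ps) jE.
  apply: tensor_right_exact => //; exact: (apx_aug_ker noethR locR pi_surj sG).
exists r; split=> //; first exact: G_betti_apx dH.
by rewrite /betti0 (has_dim_dimk pi_surj dG) (has_dim_dimk pi_surj dM) subnK.
Qed.

Lemma G_euler_sum (i L : nat) : (forall n, (L <= n)%N -> G_betti pi n M = 0%N) ->
  G_euler pi i M = \sum_(i <= n < L) (-1) ^+ (n - i) * (G_betti pi n M)%:Z.
Proof.
move=> bL; rewrite /G_euler (fsbigE (index_iota i L)).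
- rewrite big_seq_cond [RHS]big_seq; apply: eq_bigl => n.
  by rewrite mem_index_iota; apply: andb_idr => /andP[? _]; exact: mem_set.
- exact: iota_uniq.
- by move=> n /=; rewrite mem_index_iota => /andP[].
- move=> n /= ni; rewrite mem_index_iota ni /= -leqNgt => /bL ->; exact: mulr0.
Qed.

Lemma G_betti_large N : (forall n, (N <= n)%N -> trivial_module (syz n)) ->
  forall n, (N.+1 <= n)%N -> G_betti pi n M = 0%N.
Proof.
move=> syzN [//|[|n]] Nn; last by rewrite G_betti_syz; apply/mrank_eq0; exact: syzN.
have [r [_ -> _]] := G_betti1.
by have /mrank_eq0 -> : trivial_module (syz 0) by exact: syzN.
Qed.

Lemma G_euler_syz N i : (forall n, (N <= n)%N -> trivial_module (syz n)) ->
  G_euler pi i.+2 M = syz_euler noethR locR pi_surj X N i.+1.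
Proof.
move=> syzN; rewrite (G_euler_sum _ (G_betti_large syzN)) big_add1 /syz_euler /=.
rewrite !big_seq; apply: eq_bigr => -[|n]; rewrite mem_index_iota => // _.
by rewrite G_betti_syz !subSS.
Qed.

(** The rank [r] of [G_betti1] cancels; [0 < N] keeps the term of [F_0] in the range. *)
Lemma G_euler1_syz N : (forall n, (N <= n)%N -> trivial_module (syz n)) -> (0 < N)%N ->
  G_euler pi 1 M =
  syz_euler noethR locR pi_surj X N 0 + (betti0 pi M)%:Z - (betti0 pi G)%:Z.
Proof.
move=> syzN N0; rewrite (G_euler_sum _ (G_betti_large syzN)) big_add1 /syz_euler /=.
rewrite !(big_ltn N0) !subnn !expr0 !mul1r; have [r [r0 -> ->]] := G_betti1.
have -> : \sum_(1 <= n < N) (-1) ^+ (n.+1 - 1) * (G_betti pi n.+1 M)%:Z =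
    \sum_(1 <= n < N) (-1) ^+ (n - 0) * (rk n)%:Z :> int.
  by apply: eq_big_nat => -[//|n] _; rewrite G_betti_syz subSS subn0.
rewrite -subzn // PoszD; ring.
Qed.

(* [Ext^(n+1)(K, R) = Ext^(n+2)(M, R)] vanishes for [n + 2 >= i], so a minimal
   resolution of [K] cannot end at a position [>= i - 1]. *)
Lemma G_dim_syz i : (G_dim M < (i.+1%:Z)%:E)%E -> forall m, (i <= m.+1)%N ->
  trivial_module (syz m.+1).
Proof.
move=> /(G_dim_lt M (ltn0Sn i))[P [GP P0]] m im.
have eK n : (i <= n.+1)%N -> extz n X R^o.
  move=> i_n; apply: (extz_left sG).
    by case: GG => _ _ H _; apply/Ext_extz/H.
  exact: extz_Gres GP (P0 i.+1 (leqnn _)) _.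
have [N NP] := msyz_finite noethR locR pi_surj pdX.
have [Nm|] := leqP N m.+1; first exact: NP.
move=> /ltnW/subnK; move: (N - m.+1)%N => d; elim: d m im => [|d IH] m im e.
  by apply: NP; rewrite -e.
apply: msyz_ext_top; last exact: eK.
by apply: IH; [exact: leqW | rewrite addnS -addSn].
Qed.

Lemma G_dim_syzP i : (G_dim M < (i.+2%:Z)%:E)%E <-> trivial_module (syz i.+1).
Proof.
split=> [/G_dim_syz|t1]; first exact.
apply/G_dim_lt => //; exists apx; split; first exact: apx_G_resolution.
move=> [//|n]; rewrite ltnS => ni; have /mrank_eq0 r0 := msyz_trivial_le ni t1.
by move=> x; apply/rowP => j; have := ltn_ord j; rewrite {2}r0.
Qed.

Lemma G_dim_eq0 : trivial_module X -> G_dim M = 0%E.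
Proof.
move=> X0; have lt1 : (G_dim M < (1%:Z)%:E)%E.
  apply/G_dim_lt => //; exists apx; split; first exact: apx_G_resolution.
  move=> [//|n] _; have /mrank_eq0 r0 := @msyz_trivial_le _ _ _ noethR locR pi_surj X 0 n (leq0n n) X0.
  by move=> x; apply/rowP => j; have := ltn_ord j; rewrite {2}r0.
have ge0 : (0 <= G_dim M)%E.
  have [||[P _ e] _] := @infimum_attained
    [set l | exists2 P : resolution M, G_resolution P & res_length P = l]%classic.
  - by move=> _ [P _ <-]; exact: res_length_ge0.
  - by exists (res_length apx), apx => //; exact: apx_G_resolution.
  - by rewrite /G_dim -e; exact: res_length_ge0.
case: (G_dim M) lt1 ge0 => [z| |] //.
by rewrite lte_fin lee_fin => z1 z0; congr (_%:E)%E; lia.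
Qed.

(** With [K = 0] the homotopies vanish in degree 0, so homotopy inverses are inverses there, and all
    other modules are 0. *)
Lemma minimal_trivial : trivial_module X -> minimal_approximation iota.
Proof.
move=> X0 f [g [[s sE] [t tE]]] [|[|n]].
- exists (g 0%N) => x; apply/eqP; rewrite -subr_eq0; apply/eqP.
    by have := sE 0%N x; rewrite /= (X0 (s 0%N x)) linear0 addr0.
  by have := tE 0%N x; rewrite /= (X0 (t 0%N x)) linear0 addr0.
- by exists idfun => x; rewrite [LHS]X0 [RHS]X0.
- by exists idfun => x; rewrite [LHS]thinmx0 [RHS]thinmx0.
Qed.

(* If [r] retracts [iota] then [(1 - iota r, 0)] is homotopic to the identity. *)
Lemma minimal_retract (r : {linear G -> X}) :
  cancel iota r -> minimal_approximation iota -> trivial_module X.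
Proof.
move=> rK mini.
pose f n : {linear two_term_mod X G n -> two_term_mod X G n} :=
  match n return {linear two_term_mod X G n -> two_term_mod X G n} with
  0 => idfun \- (iota \o r) | _ => \0 end.
have fd n x : f n (two_term_diff iota n x) = two_term_diff iota n (f n.+1 x).
  case: n x => [|n] x; rewrite /= ?linear0 //.
  by rewrite rK subrr.
pose F : chain_map (two_term iota) (two_term iota) := @ChainMap _ (two_term iota) (two_term iota) f fd.
pose s n : {linear two_term_mod X G n -> two_term_mod X G n.+1} :=
  match n return {linear two_term_mod X G n -> two_term_mod X G n.+1} with
  0 => \- r | _ => \0 end.
have sE n x : f n x - x = two_term_diff iota n (s n x) +
    homotopy_low (C := two_term iota) (D := two_term iota) s x.
  case: n x => [|[|n]] x /=; last by rewrite [LHS]thinmx0 [RHS]thinmx0.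
    by rewrite linearN addr0 addrAC subrr add0r.
  by rewrite rK add0r.
have [|h hK _] := mini F _ 1%N.
  by exists (chain_id _); split; exists s => n x; exact: sE.
by move=> x; rewrite -(hK x) -(hK 0).
Qed.

(** [Omega_1 = 0] makes [X] isomorphic to [F_0], and [Ext^1(M, F_0) = 0] extends this isomorphism
    [c'] to [G], which gives a retraction of [iota]. *)
Lemma minimal_G_dim0 : G_dim M = 0%E -> minimal_approximation iota -> trivial_module X.
Proof.
move=> G0 mini.
have lt1 : (G_dim M < (1%:Z)%:E)%E by rewrite G0 lte_fin.
have syz1 : trivial_module (syz 1) by exact: (G_dim_syz lt1).
have ci : injective (mcover noethR locR pi_surj X).
  apply: linear_inj0 => x /(ses_exact (mses noethR locR pi_surj X 0))[y <-].
  by rewrite (syz1 y) linear0.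
have [c' [_ c'K]] := linear_inverse ci (@mcover_surj _ _ _ _ _ _ X).
have [P [GP P0]] := (G_dim_lt M (ltn0Sn 0)).1 lt1.
have eM : extz 0 M R^o by exact: extz_Gres GP (P0 1%N (leqnn _)) _.
have eM' : ext1 M 'rV[R]_(rk 0) := extz_row (rk 0) eM.
have [u uE] := eM' _ _ _ _ sG c'.
apply: (minimal_retract (r := mcover noethR locR pi_surj X \o u)) => // x.
by rewrite /= uE c'K.
Qed.

Lemma syz0_torsionless : torsionless X.
Proof.
move=> x x0; have i0 : iota x != 0.
  by apply: contra_neq x0 => e; apply: (ses_inj sG); rewrite e linear0.
have [phi phi0] := reflexive_torsionless GG i0.
by exists (phi \o iota : {linear _ -> _}).
Qed.

End GBetti.

Theorem proposition2p13 (R : comNzRingType) (k : fieldType)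
    (pi : {rmorphism R -> k}) (noethR : noetherian_ring R) (locR : local_ring R)
    (pi_surj : forall a : k, exists r : R, pi r = a)
    (M K G : lmodType R) (iota : {linear K -> G}) (p : {linear G -> M})
    (finM : fin_gen M) (GdimM : (G_dim M < +oo)%E)
    (approx : G_approximation iota p) :
  (forall i : nat, (2 <= i)%N ->
     G_euler pi i M = 0 <-> (G_dim M < (i%:Z)%:E)%E) /\
  [/\ G_euler pi 1 M = (betti0 pi M)%:Z - (betti0 pi G)%:Z <->
        (G_dim M = 0%E /\ minimal_approximation iota),
      (G_dim M = 0%E /\ minimal_approximation iota) <-> trivial_module K &
      trivial_module K -> G_euler pi 1 M = 0].
Proof.
case: approx => finK _ _ iinj iexact psurj GG pdK.
pose X := FgMod finK; have sG : ses (iota : {linear X -> G}) p by split.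
have pdX : (proj_dim X < +oo)%E := pdK.
have [N0 N0P] := msyz_finite noethR locR pi_surj pdX.
(* The successor makes the bound positive, as [G_euler1_syz] asks. *)
pose N := N0.+1.
have NP n : (N <= n)%N -> trivial_module (msyz noethR locR pi_surj X n).
  by move=> /ltnW; exact: N0P.
have iii : (G_dim M = 0%E /\ minimal_approximation iota) <-> trivial_module K.
  split=> [[G0 mini]|K0].
    exact: (@minimal_G_dim0 _ _ pi noethR locR pi_surj X G M iota p sG GG pdX G0 mini).
  split; last exact: (@minimal_trivial _ X G iota K0).
  exact: (@G_dim_eq0 _ _ pi noethR locR pi_surj X G M iota p sG GG pdX K0).
have syzE := syz_euler_eq0 NP.
split=> [[|[|i]] // _|].
  rewrite (G_euler_syz sG GG pdX i NP) (G_dim_syzP noethR locR pi_surj sG GG pdX).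
  by apply: syzE; exact: syz_torsionless.
have chi1 := G_euler1_syz sG GG pdX NP (ltn0Sn N0).
have syz0 := syzE 0%N (syz0_torsionless sG GG).
split=> // [|K0].
  (* By [chi1], condition (i) says that the alternating sum from [F_0] on is 0. *)
  rewrite iii -syz0 chi1; split; lia.
(* With [K = 0] the bound [N] can be 0, and the sum from 1 on becomes empty. *)
have syzK0 n (_ : (0 <= n)%N) : trivial_module (msyz noethR locR pi_surj X n).
  exact: (@msyz_trivial_le _ _ _ noethR locR pi_surj X 0 n (leq0n n) K0).
by rewrite (G_euler_sum _ (G_betti_large sG GG pdX syzK0)) big_geq.
Qed.
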